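(* Let $T$ be a complete first-order theory in a countable relational vocabulary $\tau$, having infinite models. Then $\mathrm{Mod}(T)$ is $\boldsymbol\Pi^0_\omega$-complete if and only if $T$ is not boundedly axiomatizable.
   Context: $\mathrm{Mod}(\tau)\subseteq 2^\omega$ is the closed subspace of Cantor space consisting of atomic diagrams of $\tau$-structures with universe $\omega$ (a Polish space), and for a theory $T$, $\mathrm{Mod}(T)=\{\mathcal A\in\mathrm{Mod}(\tau):\mathcal A\models T\}$. A first-order formula is $\forall_n$ (resp. $\exists_n$) if it is in prenex form with $n$ alternating quantifier blocks beginning with $\forall$ (resp. $\exists$). A theory $T$ has a $\forall_n$-axiomatization ($\forall_n$-axiomatizable) if some set of $\forall_n$-sentences has the same deductive closure as $T$; $T$ is boundedly axiomatizable if it has a $\forall_n$-axiomatization for some $n\in\omega$. $\boldsymbol\Sigma^0_n,\boldsymbol\Pi^0_n$ are the boldface Borel classes; $\boldsymbol\Pi^0_\omega$ is the class of countable intersections of sets in $\bigcup_n\boldsymbol\Sigma^0_n$. A set $X_1\subseteq Y_1$ is Wadge reducible to $X_2\subseteq Y_2$ if there is a continuous $f:Y_1\to Y_2$ with $y\in X_1\iff f(y)\in X_2$. For a pointclass $\Gamma$, $X$ is $\Gamma$-hard if every $\Gamma$ subset of $2^\omega$ (equivalently of any zero-dimensional Polish space) Wadge reduces to $X$, and $\Gamma$-complete if moreover $X\in\Gamma$. *)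

(* Defs.v *)
From mathcomp Require Import all_boot.
Set Implicit Arguments. Unset Strict Implicit. Unset Printing Implicit Defensive.

Section FOL.
Variables (I : countType) (ar : I -> nat).

Inductive form : Type :=
| FRel (R : I) of (ar R).-tuple nat
| FEq of nat & nat
| FFalse
| FNeg of form
| FAnd of form & form
| FOr of form & form
| FImp of form & form
| FAll of nat & form
| FEx of nat & form.

Record structure (M : Type) := Structure {
  srel : forall R : I, (ar R).-tuple M -> Prop }.

Definition upd (M : Type) (env : nat -> M) (x : nat) (m : M) : nat -> M :=
  fun y => if y == x then m else env y.

Fixpoint sat (M : Type) (A : structure M) (env : nat -> M) (f : form) : Prop :=
  match f with
  | FRel R t => srel A (map_tuple env t)
  | FEq i j => env i = env j
  | FFalse => False
  | FNeg g => ~ sat A env g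
  | FAnd g h => sat A env g /\ sat A env h
  | FOr g h => sat A env g \/ sat A env h
  | FImp g h => sat A env g -> sat A env h
  | FAll x g => forall m : M, sat A (upd env x m) g
  | FEx x g => exists m : M, sat A (upd env x m) g
  end.

Fixpoint free (x : nat) (f : form) : bool :=
  match f with
  | FRel R t => x \in (tval t)
  | FEq i j => (x == i) || (x == j)
  | FFalse => false
  | FNeg g => free x g
  | FAnd g h | FOr g h | FImp g h => free x g || free x h
  | FAll y g | FEx y g => (x != y) && free x g
  end.

Definition sentence (f : form) : Prop := forall x, free x f = false.

Fixpoint qfree (f : form) : bool :=
  match f with
  | FAll _ _ | FEx _ _ => false
  | FNeg g => qfree g
  | FAnd g h | FOr g h | FImp g h => qfree g && qfree h
  | _ => true
  end.

(* forall_n / exists_n formulas: prenex, n alternating (possibly empty)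
   quantifier blocks starting with forall (resp. exists), qf matrix. *)
Inductive AllN : nat -> form -> Prop :=
| AllN_qf f : qfree f -> AllN 0 f
| AllN_ex n f : ExN n f -> AllN n.+1 f
| AllN_all n x f : AllN n.+1 f -> AllN n.+1 (FAll x f)
with ExN : nat -> form -> Prop :=
| ExN_qf f : qfree f -> ExN 0 f
| ExN_all n f : AllN n f -> ExN n.+1 f
| ExN_ex n x f : ExN n.+1 f -> ExN n.+1 (FEx x f).

Definition theory := form -> Prop.

Definition is_model (M : Type) (A : structure M) (T : theory) : Prop :=
  forall f, T f -> forall env : nat -> M, sat A env f.

(* Semantic consequence (= deductive consequence by completeness).
   First-order structures have nonempty universes. *)
Definition conseq (T : theory) (f : form) : Prop :=
  forall (M : Type) (A : structure M), inhabited M -> is_model A T ->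
    forall env : nat -> M, sat A env f.

Definition complete_theory (T : theory) : Prop :=
  (forall f, T f -> sentence f) /\
  (exists (M : Type) (A : structure M), inhabited M /\ is_model A T) /\
  (forall f, sentence f -> conseq T f \/ conseq T (FNeg f)).

Definition has_infinite_model (T : theory) : Prop :=
  exists (M : Type) (A : structure M) (g : nat -> M), injective g /\ is_model A T.

Definition equiv_theories (T S : theory) : Prop :=
  forall f, sentence f -> (conseq T f <-> conseq S f).

Definition AllN_axiomatizable (n : nat) (T : theory) : Prop :=
  exists S : theory, (forall f, S f -> sentence f /\ AllN n f) /\ equiv_theories T S.

Definition boundedly_axiomatizable (T : theory) : Prop :=
  exists n, AllN_axiomatizable n T.

Definition atom : Type := ({R : I & (ar R).-tuple nat} + (nat * nat))%type.

Definition atom_holds (A : structure nat) (a : atom) : Prop :=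
  match a with
  | inl (existT R t) => srel A t
  | inr (i, j) => i = j
  end.

Definition diagram_of (A : structure nat) (x : nat -> bool) : Prop :=
  forall n, x n = true <-> exists a : atom, pickle a = n /\ atom_holds A a.

Definition ModTau (x : nat -> bool) : Prop := exists A : structure nat, diagram_of A x.

Definition ModT (T : theory) (x : nat -> bool) : Prop :=
  exists A : structure nat, diagram_of A x /\ is_model A T.
End FOL.

Definition cantor := nat -> bool.
Definition cset := cantor -> Prop.

Definition compl (A : cset) : cset := fun x => ~ A x.

Definition agree (n : nat) (x y : cantor) : Prop := forall i, i < n -> x i = y i.

Definition is_open (A : cset) : Prop :=
  forall x, A x -> exists n, forall y, agree n x y -> A y.

(* Sigma^0_n for n >= 1 (Sigma0 0 is empty, unused). *)
Fixpoint Sigma0 (n : nat) (A : cset) : Prop :=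
  match n with
  | 0 => False
  | 1 => is_open A
  | m.+1 => exists B : nat -> cset, (forall k, Sigma0 m (compl (B k))) /\
                                    (forall x, A x <-> exists k, B k x)
  end.

Definition Pi0 (n : nat) (A : cset) : Prop := Sigma0 n (compl A).

Definition Pi0omega (A : cset) : Prop :=
  exists B : nat -> cset, (forall k, exists n, Sigma0 n (B k)) /\
                          (forall x, A x <-> forall k, B k x).

Definition continuous_cantor (f : cantor -> cantor) : Prop :=
  forall x n, exists m, forall y, agree m x y -> f y n = f x n.

Definition wadge_reducible (X1 : cset) (Y2 X2 : cset) : Prop :=
  exists f : cantor -> cantor, continuous_cantor f /\ (forall y, Y2 (f y)) /\
    (forall y, X1 y <-> X2 (f y)).

Definition Pi0omega_hard (Y X : cset) : Prop :=
  forall A : cset, Pi0omega A -> wadge_reducible A Y X.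

Definition Pi0omega_complete (Y X : cset) : Prop :=
  Pi0omega_hard Y X /\ Pi0omega X.

(* Main.v *)
(** If [T] is bounded, [Mod(T)] is [Pi0_n] for some [n], and the Borel hierarchy
    does not collapse.

    Conversely, suppose that for each [n] there is a non-model [N_n] of [T] that
    agrees with a model [M] of [T] on all sentences with at most [n] quantifier
    alternations.  Let [A] be the intersection of sets [B_k], each of finite
    Borel rank.  Iterating the true-stage (nondeficiency) approximation of the
    jump gives nested orders [le n x] on stages such that [r <=_n s] means that
    stage [s] still believes in the rank-[n] information seen at stage [r].  At
    stage [s] we choose a complete type [p_s] in finitely many variables: a type
    of [M], or of [N_r] where [r] is the first stage still believed to witness
    that [x] lies outside some [B_k].  If [r <=_n s] then [p_r] and [p_s] must
    agree on formulas with [n] alternations.  Such a choice is possible by Ash's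
    back-and-forth argument, carried out with types rather than tuples, so no
    saturated models are needed.  Along the true stages the types converge to the
    elementary diagram of a Henkin structure on the variables, which depends
    continuously on [x] and satisfies the theory of [M] if [x] is in [A] and that
    of some [N_r] otherwise. *)
Require Import Defs.
From mathcomp Require Import all_boot.
From mathcomp Require Import boolp.
From mathcomp Require filter.
From mathcomp Require Import zify.
Set Implicit Arguments. Unset Strict Implicit. Unset Printing Implicit Defensive.

(** * Substitution and the prenex classes *)

Section Syntax.
Variables (I : countType) (ar : I -> nat).
Implicit Types f g h : form ar.

Definition equivf f g : Prop :=
  forall (M : Type) (A : structure ar M) (env : nat -> M), sat A env f <-> sat A env g.

Lemma equivf_trans g f h : equivf f g -> equivf g h -> equivf f h.
Proof. by move=> fg gh M A env; split=> [/fg /gh|/gh /fg]. Qed.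

Lemma sat_free M (A : structure ar M) f (e e' : nat -> M) :
  (forall x, free x f -> e x = e' x) -> sat A e f <-> sat A e' f.
Proof.
elim: f e e' => [R t|i j||g IH|g IHg h IHh|g IHg h IHh|g IHg h IHh|y g IH|y g IH] e e' /= E.
- suff -> : map_tuple e t = map_tuple e' t by [].
  by apply: val_inj => /=; apply/eq_in_map => x xt; apply: E.
- by rewrite (E i) ?eqxx // (E j) ?eqxx ?orbT.
- by [].
- by rewrite (IH e e').
- by rewrite (IHg e e') ?(IHh e e') // => x xf; apply: E; rewrite xf ?orbT.
- by rewrite (IHg e e') ?(IHh e e') // => x xf; apply: E; rewrite xf ?orbT.
- by rewrite (IHg e e') ?(IHh e e') // => x xf; apply: E; rewrite xf ?orbT.
- have H m : sat A (upd e y m) g <-> sat A (upd e' y m) g.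
    by apply: IH => x xg; rewrite /upd; case: eqP => // /eqP xy; apply: E; rewrite xy.
  by split=> G m; apply/H/G.
- have H m : sat A (upd e y m) g <-> sat A (upd e' y m) g.
    by apply: IH => x xg; rewrite /upd; case: eqP => // /eqP xy; apply: E; rewrite xy.
  by split=> -[m G]; exists m; apply/H/G.
Qed.

Lemma sat_sentence M (A : structure ar M) f (e e' : nat -> M) :
  sentence f -> sat A e f -> sat A e' f.
Proof. by move=> sf; rewrite (@sat_free _ A f e e') // => x; rewrite sf. Qed.

Fixpoint varbound f : nat :=
  match f with
  | FRel R t => \max_(i <- t) i.+1
  | FEq i j => maxn i.+1 j.+1
  | FFalse => 0
  | FNeg g => varbound g
  | FAnd g h | FOr g h | FImp g h => maxn (varbound g) (varbound h)
  | FAll _ g | FEx _ g => varbound g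
  end.

Lemma free_varbound x f : free x f -> x < varbound f.
Proof.
elim: f => [R t|i j||g IH|g IHg h IHh|g IHg h IHh|g IHg h IHh|y g IH|y g IH] //=.
- by move=> xt; apply: (@leq_bigmax_seq _ (tval t) predT succn x xt).
- by case/orP=> /eqP ->; rewrite leq_max leqnn ?orbT.
- by case/orP=> [/IHg|/IHh] H; rewrite leq_max H ?orbT.
- by case/orP=> [/IHg|/IHh] H; rewrite leq_max H ?orbT.
- by case/orP=> [/IHg|/IHh] H; rewrite leq_max H ?orbT.
- by case/andP=> _ /IH.
- by case/andP=> _ /IH.
Qed.

(** It lies above all values of [e] on the free variables of [f], so a binder renamed to it captures
    nothing. *)
Definition fresh (e : nat -> nat) f : nat := (\max_(i < varbound f) e i).+1.

Lemma lt_fresh e f x : free x f -> e x < fresh e f.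
Proof.
move=> /free_varbound xf; rewrite ltnS.
exact: (@leq_bigmax_cond _ predT (fun i : 'I_(varbound f) => e i) (Ordinal xf)).
Qed.

Fixpoint subst (e : nat -> nat) f : form ar :=
  match f with
  | FRel R t => FRel (map_tuple e t)
  | FEq i j => FEq ar (e i) (e j)
  | FFalse => FFalse ar
  | FNeg g => FNeg (subst e g)
  | FAnd g h => FAnd (subst e g) (subst e h)
  | FOr g h => FOr (subst e g) (subst e h)
  | FImp g h => FImp (subst e g) (subst e h)
  | FAll y g => FAll (fresh e g) (subst (upd e y (fresh e g)) g)
  | FEx y g => FEx (fresh e g) (subst (upd e y (fresh e g)) g)
  end.

Lemma sat_subst M (A : structure ar M) f (env : nat -> M) e :
  sat A env (subst e f) <-> sat A (env \o e) f.
Proof.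
elim: f env e => [R t|i j||g IH|g IHg h IHh|g IHg h IHh|g IHg h IHh|y g IH|y g IH] env e //=.
- suff -> : map_tuple env (map_tuple e t) = map_tuple (env \o e) t by [].
  by apply: val_inj => /=; rewrite map_comp.
- by rewrite IH.
- by rewrite IHg IHh.
- by rewrite IHg IHh.
- by rewrite IHg IHh.
- have H m : sat A (upd env (fresh e g) m) (subst (upd e y (fresh e g)) g) <->
             sat A (upd (env \o e) y m) g.
    rewrite IH; apply: sat_free => x xg; rewrite /upd /=.
    by case: (x == y); rewrite ?eqxx // ltn_eqF ?lt_fresh.
  by split=> G m; apply/H/G.
- have H m : sat A (upd env (fresh e g) m) (subst (upd e y (fresh e g)) g) <->
             sat A (upd (env \o e) y m) g.
    rewrite IH; apply: sat_free => x xg; rewrite /upd /=.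
    by case: (x == y); rewrite ?eqxx // ltn_eqF ?lt_fresh.
  by split=> -[m G]; exists m; apply/H/G.
Qed.

Lemma free_subst e f x : free x (subst e f) -> exists2 y, free y f & x = e y.
Proof.
elim: f e => [R t|i j||g IH|g IHg h IHh|g IHg h IHh|g IHg h IHh|y g IH|y g IH] e //=.
- by case/mapP=> y yt ->; exists y.
- by case/orP=> /eqP ->; [exists i|exists j]; rewrite ?eqxx ?orbT.
- exact: IH.
- by case/orP=> [/IHg|/IHh] [y yf ->]; exists y; rewrite ?yf ?orbT.
- by case/orP=> [/IHg|/IHh] [y yf ->]; exists y; rewrite ?yf ?orbT.
- by case/orP=> [/IHg|/IHh] [y yf ->]; exists y; rewrite ?yf ?orbT.
- case/andP=> xz /IH[u ug]; rewrite /upd; case: eqP => [_ E|/eqP uy ->].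
    by rewrite E eqxx in xz.
  by exists u; rewrite ?uy.
- case/andP=> xz /IH[u ug]; rewrite /upd; case: eqP => [_ E|/eqP uy ->].
    by rewrite E eqxx in xz.
  by exists u; rewrite ?uy.
Qed.

Lemma qfree_subst e f : qfree (subst e f) = qfree f.
Proof. by elim: f e => //= g IHg h IHh e; rewrite IHg IHh. Qed.

Scheme AllN_ExN_ind := Minimality for AllN Sort Prop
with ExN_AllN_ind := Minimality for ExN Sort Prop.
Combined Scheme AllN_ExN_mutind from AllN_ExN_ind, ExN_AllN_ind.

Lemma prenex_subst :
  (forall n f, AllN n f -> forall e, AllN n (subst e f)) /\
  (forall n f, ExN n f -> forall e, ExN n (subst e f)).
Proof.
apply: AllN_ExN_mutind => /=.
- by move=> f qf e; apply: AllN_qf; rewrite qfree_subst.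
- by move=> n f _ IH e; apply: AllN_ex.
- by move=> n x f _ IH e; apply: AllN_all.
- by move=> f qf e; apply: ExN_qf; rewrite qfree_subst.
- by move=> n f _ IH e; apply: ExN_all.
- by move=> n x f _ IH e; apply: ExN_ex.
Qed.

Lemma prenexS :
  (forall n f, AllN n f -> AllN n.+1 f) /\ (forall n f, ExN n f -> ExN n.+1 f).
Proof.
apply: AllN_ExN_mutind.
- by move=> f qf; apply/AllN_ex/ExN_qf.
- by move=> n f _; apply: AllN_ex.
- by move=> n x f _; apply: AllN_all.
- by move=> f qf; apply/ExN_all/AllN_qf.
- by move=> n f _; apply: ExN_all.
- by move=> n x f _; apply: ExN_ex.
Qed.

Lemma prenexN :
  (forall n f, AllN n f -> exists2 g, ExN n g & equivf g (FNeg f)) /\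
  (forall n f, ExN n f -> exists2 g, AllN n g & equivf g (FNeg f)).
Proof.
apply: AllN_ExN_mutind.
- by move=> f qf; exists (FNeg f) => //; apply: ExN_qf.
- by move=> n f _ [g Ag gf]; exists g => //; apply: ExN_all.
- move=> n x f _ [g Eg gf]; exists (FEx x g); first exact: ExN_ex.
  move=> M A env /=; split=> [[m /gf nf] H|H]; first exact/nf/H.
  by apply: contra_notP H => nex m; apply: contra_notP nex => nf; exists m; apply/gf.
- by move=> f qf; exists (FNeg f) => //; apply: AllN_qf.
- by move=> n f _ [g Ag gf]; exists g => //; apply: AllN_ex.
- move=> n x f _ [g Eg gf]; exists (FAll x g); first exact: AllN_all.
  move=> M A env /=; split=> [H [m fm]|H m]; first by move/gf: (H m).
  by apply/gf => fm; apply: H; exists m.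
Qed.

Definition exs (ys : seq nat) f := foldr (@FEx I ar) f ys.

Lemma ExN_S_exs n f : ExN n.+1 f -> exists ys g, f = exs ys g /\ AllN n g.
Proof.
move E: n.+1 => k Ef; elim: Ef E => // [m g Ag [->]|m x g _ IH /IH[ys [h [-> Ah]]]].
  by exists [::], g.
by exists (x :: ys), h.
Qed.

Lemma sat_exs M (A : structure ar M) ys f (env : nat -> M) :
  sat A env (exs ys f) <->
  exists env', (forall v, v \notin ys -> env' v = env v) /\ sat A env' f.
Proof.
elim: ys env => [|y ys IH] env /=.
  split=> [H|[env' [E H]]]; first by exists env.
  by rewrite (_ : env = env') //; apply/funext => v; rewrite E.
split=> [[m /IH[env' [E H]]]|[env' [E H]]].
  exists env'; split=> // v; rewrite inE negb_or => /andP[vy vys].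
  by rewrite E // /upd (negbTE vy).
exists (env' y); apply/IH; exists env'; split=> // v vys; rewrite /upd.
by case: eqP => [->//|/eqP vy]; rewrite E // inE negb_or vy.
Qed.

(** One flag covers both connectives, because De Morgan exchanges them when [prenex_bin] passes to
    negations. *)
Definition fbin (b : bool) := if b then @FAnd I ar else @FOr I ar.

Lemma fbinC b f g : equivf (fbin b f g) (fbin b g f).
Proof. by case: b => M A env /=; tauto. Qed.
End Syntax.

(** * Prenex forms with controlled alternation *)

Section Prenex.
Variables (I : countType) (ar : I -> nat).
Implicit Types f g h : form ar.

(** Renaming keeps the number of quantifiers, which is what the induction in [ExN_bin] runs on. *)
Lemma subst_exs e ys f :
  exists e' zs, subst e (exs ys f) = exs zs (subst e' f) /\ size zs = size ys.
Proof.
elim: ys e => [|y ys IH] e /=; first by exists e, [::].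
have [e' [zs [-> <-]]] := IH (upd e y (fresh e (exs ys f))).
by exists e', (fresh e (exs ys f) :: zs).
Qed.

(* Pulling one quantifier out of [exs ys f]: rename its bound variable away from
   the variables of the other operand. *)
Lemma ExN_bin b k :
  (forall f g, AllN k f -> AllN k g -> exists2 h, AllN k h & equivf h (fbin b f g)) ->
  forall f g : form ar, ExN k.+1 f -> ExN k.+1 g ->
    exists2 h, ExN k.+1 h & equivf h (fbin b f g).
Proof.
move=> H f g /ExN_S_exs[ys [f0 [-> Af]]] /ExN_S_exs[zs [g0 [-> Ag]]].
move: {2}(size ys + size zs) (erefl (size ys + size zs)) => j Ej.
elim: j ys f0 zs g0 Ej Af Ag => [|j IH] ys f0 zs g0 Ej Af Ag.
  case: ys zs Ej => [|? ?] [|? ?] //= _; have [h Ah hE] := H _ _ Af Ag.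
  by exists h => //; apply: ExN_all.
wlog: ys f0 zs g0 Ej Af Ag / 0 < size ys.
  move=> W; case: ys Ej => [|y ys] Ej; last exact: W.
  have [||h Eh hE] := W zs g0 [::] f0 _ Ag Af; rewrite ?addn0 //.
    by case: zs Ej.
  by exists h => //; apply/(equivf_trans hE)/fbinC.
case: ys Ej => // y ys [Ej] _.
clear f g; set f := exs ys f0; set g := exs zs g0.
pose z := (varbound g).+1 + fresh id f.
have [e' [ys' [Es sz]]] := subst_exs (upd id y z) ys f0.
have [||h Eh hE] := IH ys' (subst e' f0) zs g0 _ _ Ag.
- by rewrite sz.
- exact: (prenex_subst ar).1.
exists (FEx z h); first exact: ExN_ex.
have Hf M (A : structure ar M) env m :
    sat A (upd env z m) (exs ys' (subst e' f0)) <-> sat A (upd env y m) f.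
  rewrite -Es sat_subst; apply: sat_free => x xf; rewrite /upd /=.
  case: (x == y); rewrite ?eqxx // ltn_eqF //.
  exact: leq_trans (lt_fresh id xf) (leq_addl _ _).
have Hg M (A : structure ar M) env m : sat A (upd env z m) g <-> sat A env g.
  apply: sat_free => x /free_varbound xg; rewrite /upd ltn_eqF //.
  by apply: ltn_addr; apply: leqW.
(* An assignment exhibits an element of the universe, needed to move an existential quantifier out
   of a disjunction whose other side is the true one. *)
move=> M A env; have m0 := env 0.
move: (hE M A); rewrite /=; case: b {H IH hE} => /= hE; split.
- by move=> [m /hE[/Hf fm /Hg gm]]; split=> //; exists m.
- by move=> [[m fm] gm]; exists m; apply/hE; split; [apply/Hf|apply/Hg].
- by move=> [m /hE[/Hf fm|/Hg gm]]; [left; exists m|right].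
- move=> [[m fm]|gm]; first by exists m; apply/hE; left; apply/Hf.
  by exists m0; apply/hE; right; apply/Hg.
Qed.

Lemma prenex_bin k b :
  (forall f g, ExN k f -> ExN k g -> exists2 h, ExN k h & equivf h (fbin b f g)) /\
  (forall f g : form ar, AllN k f -> AllN k g -> exists2 h, AllN k h & equivf h (fbin b f g)).
Proof.
elim: k b => [|k IH] b.
  split=> f g Hf Hg; exists (fbin b f g) => //.
    have qf : qfree f by inversion Hf.
    have qg : qfree g by inversion Hg.
    by apply: ExN_qf; case: b; rewrite /= qf qg.
  have qf : qfree f by inversion Hf.
  have qg : qfree g by inversion Hg.
  by apply: AllN_qf; case: b; rewrite /= qf qg.
have HE c := ExN_bin (IH c).2; split; first exact: HE.
move=> f g /(prenexN ar).1[f' Ef ff] /(prenexN ar).1[g' Eg gg].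
have [h /(prenexN ar).2[h' Ah hh] hE] := HE (~~ b) _ _ Ef Eg.
exists h' => // M A env; move: (hh M A env) (hE M A env) (ff M A env) (gg M A env).
by case: b {hE} => /=; case: (pselect (sat A env f)); case: (pselect (sat A env g)); tauto.
Qed.

Definition isEx f := if f is FEx _ _ then true else false.
Definition isAll f := if f is FAll _ _ then true else false.

(* Alternation rank: a block of like quantifiers counts for one. *)
Fixpoint rk f : nat :=
  match f with
  | FRel _ _ | FEq _ _ | FFalse => 0
  | FNeg g => rk g
  | FAnd g h | FOr g h | FImp g h => maxn (rk g) (rk h)
  | FAll _ g => if isAll g then rk g else (rk g).+1
  | FEx _ g => if isEx g then rk g else (rk g).+1
  end.

Lemma rk_gt0 f : isEx f || isAll f -> 0 < rk f.
Proof.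
by elim: f => //= y g IH _; case: ifP => // E; apply: IH; rewrite E ?orbT.
Qed.

Lemma rk_subst e f : rk (subst e f) = rk f.
Proof.
have HE e' g : isEx (subst e' g) = isEx g by case: g.
have HA e' g : isAll (subst e' g) = isAll g by case: g.
by elim: f e => //= [g IHg h IHh|g IHg h IHh|g IHg h IHh|y g IH|y g IH] e;
  rewrite ?IHg ?IHh ?HE ?HA ?IH.
Qed.

Lemma rk_exs ys f : rk (exs ys f) <= (rk f).+1.
Proof.
elim: ys => [|y [|z ys] IH] //=; first by case: isEx.
Qed.

Definition AllN_equiv n f := exists2 g, AllN n g & equivf g f.
Definition ExN_equiv n f := exists2 g, ExN n g & equivf g f.

Lemma equiv_neg n f :
  (AllN_equiv n f -> ExN_equiv n (FNeg f)) /\ (ExN_equiv n f -> AllN_equiv n (FNeg f)).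
Proof.
split=> -[g].
  move=> /(prenexN ar).1 [h Hh hg] gf; exists h => // M A env /=.
  by rewrite (hg M A env) /= (gf M A env).
move=> /(prenexN ar).2 [h Hh hg] gf; exists h => // M A env /=.
by rewrite (hg M A env) /= (gf M A env).
Qed.

Lemma equiv_bin n b f g :
  (AllN_equiv n f -> AllN_equiv n g -> AllN_equiv n (fbin b f g)) /\
  (ExN_equiv n f -> ExN_equiv n g -> ExN_equiv n (fbin b f g)).
Proof.
split=> -[f' Hf ff] [g' Hg gg].
  have [h Hh hE] := (prenex_bin n b).2 _ _ Hf Hg; exists h => // M A env.
  by rewrite (hE M A env); case: b {hE} => /=; rewrite (ff M A env) (gg M A env).
have [h Hh hE] := (prenex_bin n b).1 _ _ Hf Hg; exists h => // M A env.
by rewrite (hE M A env); case: b {hE} => /=; rewrite (ff M A env) (gg M A env).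
Qed.

(** The last two clauses strengthen the induction: a formula that begins with a quantifier lies in
    the matching class at its own rank, so a further quantifier of the same kind joins the leading
    block at no cost. *)
Lemma rk_prenex f n : rk f <= n ->
  [/\ AllN_equiv n.+1 f, ExN_equiv n.+1 f,
      isEx f -> ExN_equiv n f & isAll f -> AllN_equiv n f].
Proof.
have Hqf k g : qfree g -> AllN_equiv k g /\ ExN_equiv k g.
  move=> qg; elim: k => [|k [[a Ea aE] [b Eb bE]]].
    by split; exists g => //; [apply: AllN_qf|apply: ExN_qf].
  by split; [exists a => //; apply: (prenexS ar).1|exists b => //; apply: (prenexS ar).2].
elim: f n => [R t|i j||g IH|g IHg h IHh|g IHg h IHh|g IHg h IHh|y g IH|y g IH] n.
- by move=> _; split=> //; apply: (Hqf _ _ _).1 || apply: (Hqf _ _ _).2.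
- by move=> _; split=> //; apply: (Hqf _ _ _).1 || apply: (Hqf _ _ _).2.
- by move=> _; split=> //; apply: (Hqf _ _ _).1 || apply: (Hqf _ _ _).2.
- by move=> /IH[a e _ _]; split=> //; [apply: (equiv_neg _ _).2|apply: (equiv_neg _ _).1].
- rewrite /= geq_max => /andP[/IHg[ag eg _ _] /IHh[ah eh _ _]]; split=> //.
    exact: (equiv_bin _ true _ _).1.
  exact: (equiv_bin _ true _ _).2.
- rewrite /= geq_max => /andP[/IHg[ag eg _ _] /IHh[ah eh _ _]]; split=> //.
    exact: (equiv_bin _ false _ _).1.
  exact: (equiv_bin _ false _ _).2.
- rewrite /= geq_max => /andP[/IHg[ag eg _ _] /IHh[ah eh _ _]].
  have E : equivf (fbin false (FNeg g) h) (FImp g h).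
    by move=> M A env /=; case: (pselect (sat A env g)); tauto.
  split=> //.
    have [k Ak kE] := (equiv_bin _ false _ _).1 ((equiv_neg _ _).2 eg) ah.
    by exists k => //; apply: equivf_trans E.
  have [k Ak kE] := (equiv_bin _ false _ _).2 ((equiv_neg _ _).1 ag) eh.
  by exists k => //; apply: equivf_trans E.
- move=> rn; have {rn IH} [a Aa aE] : AllN_equiv n (FAll y g).
    case: n rn => [|n] /=; first by rewrite leqNgt (rk_gt0 (f := FAll y g)).
    case: ifP => Eg rg.
      have [_ _ _ /(_ Eg) [a Aa aE]] := IH _ rg; exists (FAll y a); first exact: AllN_all.
      by move=> M A env /=; split=> H m; apply/aE.
    have [[a Aa aE] _ _ _] := IH _ rg; exists (FAll y a); first exact: AllN_all.
    by move=> M A env /=; split=> H m; apply/aE.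
  split=> //; last by exists a.
    by exists a => //; apply: (prenexS ar).1.
  by exists a => //; apply: ExN_all.
- move=> rn; have {rn IH} [a Aa aE] : ExN_equiv n (FEx y g).
    case: n rn => [|n] /=; first by rewrite leqNgt (rk_gt0 (f := FEx y g)).
    case: ifP => Eg rg.
      have [_ _ /(_ Eg) [a Aa aE] _] := IH _ rg; exists (FEx y a); first exact: ExN_ex.
      by move=> M A env /=; split=> -[m H]; exists m; apply/aE.
    have [_ [a Aa aE] _ _] := IH _ rg; exists (FEx y a); first exact: ExN_ex.
    by move=> M A env /=; split=> -[m H]; exists m; apply/aE.
  split=> //; last by exists a.
    by exists a => //; apply: AllN_ex.
  by exists a => //; apply: (prenexS ar).2.
Qed.

Definition alls (ys : seq nat) f := foldr (@FAll I ar) f ys.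

Lemma sat_alls M (A : structure ar M) ys f (env : nat -> M) :
  (forall env', sat A env' f) -> sat A env (alls ys f).
Proof. by move=> H; elim: ys env => //= y ys IH env m; apply: IH. Qed.

Lemma sat_alls_inv M (A : structure ar M) ys f (env : nat -> M) :
  sat A env (alls ys f) -> sat A env f.
Proof.
elim: ys env => //= y ys IH env /(_ (env y)) /IH.
by rewrite (_ : upd _ _ _ = env) //; apply/funext => x; rewrite /upd; case: eqP => // ->.
Qed.

Lemma free_alls ys f x : free x (alls ys f) = (x \notin ys) && free x f.
Proof. by elim: ys => //= y ys ->; rewrite inE negb_or andbA. Qed.

(** The prenex form is only known to be equivalent to [f] and may have free variables. Its universal
    closure stays in [AllN n.+1], and changes nothing because [f] is a sentence. *)
Lemma sentence_AllN f n : sentence f -> rk f <= n ->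
  exists g, [/\ sentence g, AllN n.+1 g & equivf g f].
Proof.
move=> sf /rk_prenex[[g Ag gf] _ _ _]; exists (alls (iota 0 (varbound g)) g); split.
- move=> x; rewrite free_alls mem_iota add0n leq0n /=.
  by case E: (free x g); rewrite ?andbF // (free_varbound E).
- by elim: iota => //= y ys; apply: AllN_all.
- move=> M A env; split=> [/sat_alls_inv /gf //|fe].
  by apply: sat_alls => env'; apply/gf/sat_sentence/fe.
Qed.
End Prenex.

(** * Complete types finitely satisfiable in a structure, amalgamation and Henkin witnesses *)

Section Types.
Variables (I : countType) (ar : I -> nat).
Implicit Types (f g h : form ar) (p q r : form ar -> Prop).

Definition below l f : Prop := forall x, free x f -> x < l.

Lemma below_and l f g : below l (FAnd f g) <-> below l f /\ below l g.
Proof.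
split=> [H|[Hf Hg] x /orP[/Hf|/Hg] //].
by split=> x xf; apply: H => /=; rewrite xf ?orbT.
Qed.

Lemma below_subst e l f : (forall x, free x f -> e x < l) -> below l (subst e f).
Proof. by move=> H x /free_subst[y /H yl ->]. Qed.

Lemma below_ge l l' f : l <= l' -> below l f -> below l' f.
Proof. by move=> ll H x /H /leq_trans; apply. Qed.

(* A complete type in all variables, finitely satisfiable in [A]: [type_mono] is
   about consequence in the one structure [A] (see [type_sat]). *)
Record is_type M (A : structure ar M) p : Prop := IsType {
  type_neg : forall f, p (FNeg f) <-> ~ p f;
  type_and : forall f g, p (FAnd f g) <-> p f /\ p g;
  type_mono : forall f g, (forall e, sat A e f -> sat A e g) -> p f -> p g }.

Section OneStructure.
Variables (M : Type) (A : structure ar M).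

Lemma type_sat p f : is_type A p -> p f -> exists e, sat A e f.
Proof.
move=> tp pf; apply: contrapT => ne; have := (type_neg tp f).1; apply=> //.
by apply: (type_mono tp) pf => e fe; case: ne; exists e.
Qed.

Lemma type_sentence p f (e : nat -> M) : is_type A p -> sentence f -> p f <-> sat A e f.
Proof.
move=> tp sf; split=> [/(type_sat tp)[e']|fe]; first exact: sat_sentence.
apply: contrapT => /(type_neg tp) /(type_sat tp)[e' /= nf]; apply: nf.
exact: sat_sentence fe.
Qed.

Lemma type_equiv p f g : is_type A p -> (forall e, sat A e f <-> sat A e g) -> p f <-> p g.
Proof. by move=> tp fg; split; apply: (type_mono tp) => e /fg. Qed.

Lemma type_valid p f : is_type A p -> (forall e, sat A e f) -> p f.
Proof.
move=> tp H; apply: contrapT => /(type_neg tp) /(type_sat tp)[e /=]; apply; exact: H.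
Qed.

Lemma type_true p : is_type A p -> p (FNeg (FFalse ar)).
Proof. by move=> tp; apply: (type_valid tp) => e []. Qed.

(** A substitute for compactness: the solution sets of [G] generate a filter on the assignments, and
    the type consists of the formulas true on a large set for an ultrafilter extending it. *)
Lemma type_exists (G : form ar -> Prop) :
  (exists f, G f) ->
  (forall f g, G f -> G g -> exists2 h, G h & forall e, sat A e h -> sat A e f /\ sat A e g) ->
  (forall f, G f -> exists e, sat A e f) ->
  exists2 p, is_type A p & forall f, G f -> p f.
Proof.
move=> [f0 G0] GI Gsat.
pose F (X : (nat -> M) -> Prop) := exists2 f, G f & forall e, sat A e f -> X e.
have PF : filter.ProperFilter F.
  split; first by move=> [f /Gsat[e fe] H]; exact: H fe.
  split; first by exists f0.
    move=> X Y [f Gf fX] [g Gg gY]; have [h Gh hh] := GI _ _ Gf Gg.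
    by exists h => // e /hh[/fX ? /gY].
  by move=> X Y XY [f Gf fX]; exists f => // e /fX /XY.
have [U [UU FU]] := filter.ultraFilterLemma PF.
have PU := filter.ultra_proper (UltraFilter := UU).
have FlU := @filter.filter_filter _ _ PU.
have US := @filter.filterS _ _ FlU.
exists (fun f => U (fun e => sat A e f)); last first.
  by move=> f Gf; apply: FU; exists f.
split.
- move=> f; split=> [Un Uf|nUf].
    apply: (@filter.filter_not_empty _ _ PU).
    by apply: US (@filter.filterI _ _ FlU _ _ Un Uf) => e [].
  by have [//|] := @filter.in_ultra_setVsetC _ U (fun e => sat A e f) UU.
- move=> f g; split=> [Ufg|[Uf Ug]].
    by split; apply: US Ufg => e [].
  exact: (@filter.filterI _ _ FlU _ _ Uf Ug).
- by move=> f g fg; apply: US.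
Qed.

Lemma type_trivial : inhabited M -> exists p, is_type A p.
Proof.
move=> [m].
have [||f ->|p tp _] := type_exists (G := fun f => f = FEq ar 0 0).
- by exists (FEq ar 0 0).
- by move=> f g -> ->; exists (FEq ar 0 0).
- by exists (fun=> m).
- by exists p.
Qed.
End OneStructure.

Definition agree_below l p q : Prop := forall f, below l f -> (p f <-> q f).
Definition agree_rk n l p q : Prop := forall f, rk f <= n -> below l f -> (p f <-> q f).

Lemma agree_belowI M (A : structure ar M) N (B : structure ar N) l p q :
  is_type A p -> is_type B q -> (forall f, below l f -> p f -> q f) -> agree_below l p q.
Proof.
move=> tp tq H f bf; split; first exact: H.
by move=> qf; apply: contrapT => /(type_neg tp) /H nqf; have /(type_neg tq) := nqf bf.
Qed.

Lemma agree_rkI M (A : structure ar M) N (B : structure ar N) n l p q :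
  is_type A p -> is_type B q ->
  (forall f, rk f <= n -> below l f -> p f -> q f) -> agree_rk n l p q.
Proof.
move=> tp tq H f rf bf; split; first exact: H.
by move=> qf; apply: contrapT => /(type_neg tp) /H nqf; have /(type_neg tq) := nqf rf bf.
Qed.

(** By [type_exists] it is enough to satisfy one formula of [p] below [l] together with one formula
    of [r] of rank at most [n] below [l']. Quantifying away the variables from [l] on turns the
    second into a formula below [l] of rank at most [n.+1], which [p] shares with [r]. That
    quantifier block is the rank lost. *)
Lemma amalgamation M (A : structure ar M) N (B : structure ar N) n l l' p r :
  is_type A p -> is_type B r -> agree_rk n.+1 l p r ->
  exists q, [/\ is_type A q, agree_below l p q & agree_rk n l' r q].
Proof.
move=> tp tr pr.
pose Gp f := below l f /\ p f; pose Gr f := [/\ rk f <= n, below l' f & r f].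
pose T := FNeg (FFalse ar).
have GpT : Gp T by split=> //; exact: type_true tp.
have GrT : Gr T by split=> //; exact: type_true tr.
pose G f := exists f1 f2, [/\ f = FAnd f1 f2, Gp f1 & Gr f2].
have [| | |q tq Gq] := type_exists (A := A) (G := G).
- by exists (FAnd T T), T, T.
- move=> _ _ [f1 [f2 [-> [bf1 pf1] [rf2 bf2 qf2]]]] [g1 [g2 [-> [bg1 pg1] [rg2 bg2 qg2]]]].
  exists (FAnd (FAnd f1 g1) (FAnd f2 g2)); last by move=> e /=; tauto.
  exists (FAnd f1 g1), (FAnd f2 g2); split=> //.
    by split; [apply/below_and|apply/(type_and tp)].
  split; [by rewrite /= geq_max rf2|exact/below_and|exact/(type_and tr)].
- move=> _ [f1 [f2 [-> [b1 p1] [k2 b2 r2]]]].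
  pose ys := iota l (l' - l).
  have ysE v : (v \in ys) = (l <= v < l + (l' - l)) by rewrite mem_iota.
  have bex : below l (exs ys f2).
    move=> x; have fE zs : free x (exs zs f2) = (x \notin zs) && free x f2.
      by elim: zs => //= z zs ->; rewrite inE negb_or andbA.
    rewrite fE ysE => /andP[nx /b2 xl']; lia.
  have rex : r (exs ys f2).
    by apply: (type_mono tr) r2 => e fe; apply/sat_exs; exists e.
  have pex : p (exs ys f2) by apply/pr => //; apply: leq_trans (rk_exs _ _) _.
  have [e /= [fe /sat_exs[e' [ee fe']]]] := type_sat tp ((type_and tp _ _).2 (conj p1 pex)).
  exists e'; split=> //; rewrite (@sat_free _ _ _ _ _ _ e) // => x /b1 xl.
  by rewrite ee // ysE leqNgt xl.
exists q; split=> //.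
- apply: (agree_belowI tp tq) => f bf pf.
  have : q (FAnd f T) by apply: Gq; exists f, T.
  by case/(type_and tq).
- apply: (agree_rkI tr tq) => f rf bf pf.
  have : q (FAnd T f) by apply: Gq; exists T, f.
  by case/(type_and tq).
Qed.

(** The variables will be the elements of the limit structure, where equality is identity of
    indices; hence types must keep the variables in use apart. *)
Definition distinct_below l p : Prop := forall i j, i < l -> j < l -> i != j -> ~ p (FEq ar i j).

Definition infinite (M : Type) := forall l (e : nat -> M), exists w, forall i, i < l -> e i <> w.

Definition ands (fs : seq (form ar)) := foldr (@FAnd I ar) (FNeg (FFalse ar)) fs.

Lemma sat_ands M (A : structure ar M) e (F : nat -> form ar) n :
  sat A e (ands (map F (iota 0 n))) <-> forall i, i < n -> sat A e (F i).
Proof.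
have H m : sat A e (ands (map F (iota m n))) <-> forall i, m <= i < m + n -> sat A e (F i).
  elim: n m => [|n IH] m /=.
    by split=> [_ i|//]; lia.
  split=> [[Fm /IH H] i Hi|H].
    by have [->//|im] := eqVneq i m; apply: H; lia.
  split; first by apply: H; lia.
  by apply/IH => i Hi; apply: H; lia.
by rewrite H; split=> Hi i; [move=> il; apply: Hi|case/andP=> _; apply: Hi].
Qed.

Lemma type_ands M (A : structure ar M) p (F : nat -> form ar) n : is_type A p ->
  (forall i, i < n -> p (F i)) -> p (ands (map F (iota 0 n))).
Proof.
move=> tp H; have {H} : forall i, i \in iota 0 n -> p (F i).
  by move=> i; rewrite mem_iota => /andP[_]; apply: H.
elim: (iota 0 n) => [|k s IH] H /=; first exact: type_true tp.
apply/(type_and tp); split; first by apply: H; rewrite mem_head.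
by apply: IH => i si; apply: H; rewrite inE si orbT.
Qed.

Lemma agree_below_trans l l' p q r : l <= l' ->
  agree_below l p q -> agree_below l' q r -> agree_below l p r.
Proof. by move=> ll pq qr f bf; rewrite (pq f bf) (qr f (below_ge ll bf)). Qed.

Section Henkin.
Variables (M : Type) (A : structure ar M).
Hypothesis Minf : infinite M.

(** Compactness again: the variable [l] can be made to satisfy [f] and differ from all earlier ones
    as soon as this is possible along with each single formula of [p] below [l]. *)
Lemma new_variable p l f :
  is_type A p -> distinct_below l p ->
  (forall g, below l g -> p g ->
    exists e w, [/\ sat A e g, sat A (upd e l w) f & forall i, i < l -> e i <> w]) ->
  exists q, [/\ is_type A q, agree_below l p q, distinct_below l.+1 q & q f].
Proof.
move=> tp dp H.
pose D := ands [seq FNeg (FEq ar i l) | i <- iota 0 l].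
pose G h := exists g, [/\ h = FAnd g (FAnd f D), below l g & p g].
have Ttop : below l (FNeg (FFalse ar)) /\ p (FNeg (FFalse ar)).
  by split=> //; exact: type_true tp.
have [| | |q tq Gq] := type_exists (A := A) (G := G).
- by exists (FAnd (FNeg (FFalse ar)) (FAnd f D)), (FNeg (FFalse ar)); case: Ttop.
- move=> _ _ [g [-> bg pg]] [h [-> bh ph]]; exists (FAnd (FAnd g h) (FAnd f D)).
    by exists (FAnd g h); split=> //; [apply/below_and|apply/(type_and tp)].
  by move=> e /=; tauto.
- move=> _ [g [-> bg pg]]; have [e [w [ge fw dw]]] := H g bg pg.
  exists (upd e l w) => /=; split.
    rewrite (@sat_free _ _ _ _ _ _ e) // => x /bg xl.
    by rewrite /upd (ltn_eqF xl).
  split=> //; apply/sat_ands => i il /=; rewrite /upd eqxx (ltn_eqF il).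
  exact: dw.
have qD : q D /\ q f.
  have /(type_and tq)[_ /(type_and tq)[]] // :
    q (FAnd (FNeg (FFalse ar)) (FAnd f D)).
  by apply: Gq; exists (FNeg (FFalse ar)); case: Ttop.
have pq : agree_below l p q.
  apply: (agree_belowI tp tq) => g bg pg.
  by have /(type_and tq)[] : q (FAnd g (FAnd f D)) by apply: Gq; exists g.
exists q; split=> //; last by case: qD.
have dl i : i < l -> ~ q (FEq ar i l).
  move=> il; apply/(type_neg tq); apply: (type_mono tq) qD.1 => e /sat_ands; exact.
move=> i j; rewrite !ltnS leq_eqVlt => /orP[/eqP -> |il].
  rewrite leq_eqVlt => /orP[/eqP -> |jl]; first by rewrite eqxx.
  by move=> _ /(type_mono tq (g := FEq ar j l)) H'; apply: (dl j jl); apply: H' => e /=.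
rewrite leq_eqVlt => /orP[/eqP -> _|jl ij]; first exact: dl.
move=> /pq qij; apply: (dp i j il jl ij); apply: qij => x /=.
by case/orP=> /eqP ->.
Qed.

Definition witnessed l p z f := exists2 m, m < l & p (subst (upd id z m) f).

Lemma sat_subst_upd (e : nat -> M) z m f :
  sat A e (subst (upd id z m) f) <-> sat A (upd e z (e m)) f.
Proof. by rewrite sat_subst; apply: sat_free => x _; rewrite /upd /=; case: eqP. Qed.

Lemma below_subst_upd l z m f : below l (FEx z f) -> m < l -> below l (subst (upd id z m) f).
Proof.
move=> bf ml; apply: below_subst => x xf; rewrite /upd; case: eqP => // /eqP xz.
by apply: bf; rewrite /= xz.
Qed.

(** Either a variable already in use is a witness, or none is. In the second case any element
    satisfying [f] differs from the values of the variables in use, so a new variable can name it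
    without breaking distinctness. *)
Lemma add_witness p l z f :
  is_type A p -> distinct_below l p -> below l (FEx z f) -> p (FEx z f) ->
  exists q l', [/\ l <= l', is_type A q, agree_below l p q, distinct_below l' q
                & witnessed l' q z f].
Proof.
move=> tp dp bf pf.
have [wit|nwit] := pselect (witnessed l p z f); first by exists p, l; split.
have [|q [tq pq dq qf]] := new_variable (f := subst (upd id z l) f) tp dp.
  move=> g bg pg.
  (* [W] says that no variable in use is a witness; it belongs to [p], so it can be satisfied
     together with [g] and the existential formula. *)
  pose W := ands [seq FNeg (subst (upd id z m) f) | m <- iota 0 l].
  have pW : p W.
    by apply: (type_ands tp) => m ml; apply/(type_neg tp) => pm; apply: nwit; exists m.
  have [e /= [ge [[w fw] /sat_ands We]]] :=
    type_sat tp ((type_and tp _ _).2 (conj pg ((type_and tp _ _).2 (conj pf pW)))).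
  exists e, w; split=> //.
    apply/sat_subst; move: fw; rewrite (@sat_free _ _ _ _ _ (upd e z w) (upd e l w \o upd id z l)) //.
    move=> x xf; rewrite /upd /=; case: ifP => [|xz]; rewrite ?eqxx //.
    by rewrite ltn_eqF //; apply: bf; rewrite /= xz.
  by move=> i il Ew; apply: (We i il); apply/sat_subst_upd; rewrite Ew.
exists q, l.+1; split=> //; by exists l.
Qed.

(** Infinity of the structure is used here: it makes the number of variables grow strictly, so that
    every natural number becomes an element of the limit. *)
Lemma add_fresh p l : is_type A p -> distinct_below l p ->
  exists q, [/\ is_type A q, agree_below l p q & distinct_below l.+1 q].
Proof.
move=> tp dp; have [|q [tq pq dq _]] := new_variable (f := FEq ar 0 0) tp dp; last by exists q.
move=> g bg pg; have [e ge] := type_sat tp pg; have [w Hw] := Minf l e.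
by exists e, w.
Qed.

Lemma add_witnesses (F : nat -> nat * form ar) n p l :
  is_type A p -> distinct_below l p ->
  exists q l', [/\ l < l', is_type A q, agree_below l p q, distinct_below l' q &
    forall k, k < n -> below l (FEx (F k).1 (F k).2) -> p (FEx (F k).1 (F k).2) ->
      witnessed l' q (F k).1 (F k).2].
Proof.
move=> tp dp; elim: n => [|n [q [l' [ll tq pq dq wq]]]].
  by have [q [tq pq dq]] := add_fresh tp dp; exists q, l.+1.
have [[bn pn]|nbp] :=
  pselect (below l (FEx (F n).1 (F n).2) /\ p (FEx (F n).1 (F n).2)); last first.
  exists q, l'; split=> // k; rewrite ltnS leq_eqVlt => /orP[/eqP -> bk pk|/wq //].
  by case: nbp.
have [|q2 [l2 [ll2 tq2 qq2 dq2 wn]]] := add_witness tq dq (below_ge (ltnW ll) bn).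
  exact/pq.
exists q2, l2; split=> //; first exact: leq_trans ll2.
  exact: agree_below_trans (ltnW ll) pq qq2.
move=> k; rewrite ltnS leq_eqVlt => /orP[/eqP -> //|kn bk pk].
have [m ml qm] := wq k kn bk pk; exists m; first exact: leq_trans ll2.
by apply/qq2 => //; apply: below_subst_upd ml; apply: below_ge bk; apply: ltnW.
Qed.
End Henkin.
End Types.

(** * One step of the nondeficiency approximation of the jump *)

Section Jump.
(* [le s t]: stage [t] still believes in stage [s]; [hold a s]: the event [a] is
   believed at stage [s] to have occurred. *)
Variables (le : nat -> nat -> Prop) (hold : nat -> nat -> Prop).

Definition newly s a : Prop := hold a s /\ forall r, r < s -> le r s -> ~ hold a r.

Lemma least_exists s : exists a, (a == s) || `[< newly s a >].
Proof. by exists s; rewrite eqxx. Qed.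

(** The cap [s] keeps the minimum defined when nothing new is believed; along an infinite path it
    ends up above any fixed event. *)
Definition least s : nat := ex_minn (least_exists s).

(** Nondeficiency relative to [t]: no stage after [s] that [t] believes brings news smaller than
    [least s]. *)
Definition jle s t : Prop := le s t /\ forall r, s < r -> le r t -> least s <= least r.

(** The belief that event [c] never happens: a later occurrence would be news below [least s], and
    so would break [jle]. *)
Definition jneg c s : Prop := c < least s /\ ~ hold c s.

Definition jhold (ch : nat -> nat -> nat) a s : Prop := exists j, jneg (ch a j) s.

Lemma least_newly s a : newly s a -> least s <= a.
Proof.
rewrite /least; case: ex_minnP => m _ H na; apply: H; apply/orP; right; exact/asboolP.
Qed.

Lemma leastP s : least s = s \/ newly s (least s).
Proof.
rewrite /least; case: ex_minnP => m /orP[/eqP|/asboolP]; by [left|right].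
Qed.

Record tree_order : Prop := TreeOrder {
  tle_refl : forall s, le s s;
  tle_leq : forall s t, le s t -> s <= t;
  tle_trans : forall s t u, le s t -> le t u -> le s u;
  tle_tree : forall r s t, le r t -> le s t -> r <= s -> le r s;
  hold_pers : forall a s t, le s t -> hold a s -> hold a t }.

Hypothesis TO : tree_order.

Lemma minimal_stage (P : nat -> Prop) : (exists r, P r) ->
  exists2 r, P r & forall u, P u -> r <= u.
Proof.
move=> [r0 /asboolP Pr0]; have ex : exists r, `[< P r >] by exists r0.
exists (ex_minn ex); first by case: ex_minnP => m /asboolP.
by move=> u /asboolP Pu; case: ex_minnP => m _; apply.
Qed.

(** Otherwise take the first stage [r] after [s], believed at [t], where [c] holds. There [c] is
    new, so [least r <= c < least s], against [jle s t]. *)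
Lemma jneg_pers c s t : jle s t -> jneg c s -> jneg c t.
Proof.
move=> [st H] [cs nc].
have ls : least s <= least t.
  have := tle_leq TO st; rewrite leq_eqVlt => /orP[/eqP -> //|lt]; apply: H => //.
  exact: tle_refl.
split=> [|ct]; first exact: leq_trans ls.
have [|r [sr rt cr] rmin] := minimal_stage (P := fun r => [/\ s < r, le r t & hold c r]).
  exists t; split=> //; last exact: tle_refl.
  by rewrite ltn_neqAle (tle_leq TO st) andbT; apply/eqP => E; rewrite E in nc.
have : least r <= c.
  apply: least_newly; split=> // u ur uler cu.
  have ut := tle_trans TO uler rt.
  case: (leqP u s) => [us|su]; first by apply: nc; apply: (hold_pers TO) cu; apply: tle_tree ut st us.
  by have := rmin u (And3 su ut cu); rewrite leqNgt ur.
by rewrite leqNgt (leq_trans cs) // H.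
Qed.

(** The fourth clause is stronger than the tree property, since [s] need only be believed at [t] in
    the sense of [le]. The back-and-forth construction needs this form. *)
Lemma jump_tree_order ch :
  [/\ forall s, jle s s, forall s t, jle s t -> s <= t,
      forall s t u, jle s t -> jle t u -> jle s u,
      forall r s t, jle r t -> le s t -> r <= s -> jle r s
    & forall a s t, jle s t -> jhold ch a s -> jhold ch a t].
Proof.
split.
- move=> s; split; first exact: tle_refl.
  by move=> r sr /(tle_leq TO); rewrite leqNgt sr.
- by move=> s t [/(tle_leq TO)].
- move=> s t u [st Hst] [tu Htu]; split; first exact: tle_trans tu.
  move=> r sr ru; case: (leqP r t) => rt; first by apply: Hst => //; apply: tle_tree ru tu rt.
  apply: leq_trans (Htu r rt ru); have := tle_leq TO st; rewrite leq_eqVlt.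
  by case/orP=> [/eqP -> //|lt]; apply: Hst => //; apply: (tle_refl TO).
- move=> r s t [rt H] st rs; split; first exact: tle_tree rt st rs.
  by move=> u ru us; apply: H => //; apply: tle_trans st.
- by move=> a s t st [j /(jneg_pers st)]; exists j.
Qed.

Section TruePath.
Variables (T : nat -> Prop) (holds_x : nat -> Prop).

Record true_path : Prop := TruePath {
  path_inf : forall k, exists2 s, k <= s & T s;
  path_le : forall s t, T s -> T t -> s <= t -> le s t;
  path_down : forall s t, T t -> le s t -> T s;
  path_hold : forall a, holds_x a <-> exists2 s, T s & hold a s }.

Hypothesis TP : true_path.

Definition jtrue s : Prop := T s /\ forall t, s < t -> T t -> least s <= least t.

(** An event is new at most once along the path, so each value of [least] is avoided from some stage
    on. *)
Lemma least_unbounded a : exists k, forall s, k <= s -> T s -> a <= least s.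
Proof.
elim: a => [|a [k IH]]; first by exists 0.
have [[s Ts na]|nex] := pselect (exists2 s, T s & newly s a).
  (* Here [s.+1] lies past the only path stage where [a] is new, and [a.+1] excludes the capped
     value [least t = t]. *)
  exists (maxn k (maxn s.+1 a.+1)) => t; rewrite !geq_max => /and3P[kt st at_] Tt.
  rewrite ltn_neqAle IH // andbT; apply/eqP => E.
  have := leastP t; rewrite -E => -[Et|[_ /(_ s st)]]; first by rewrite Et ltnn in at_.
  by case; [apply: path_le => //; apply: ltnW|case: na].
exists (maxn k a.+1) => t; rewrite geq_max => /andP[kt at_] Tt.
rewrite ltn_neqAle IH // andbT; apply/eqP => E.
have := leastP t; rewrite -E => -[Et|na]; first by rewrite Et ltnn in at_.
by apply: nex; exists t.
Qed.

(** A path stage that minimizes [least] among those from [k] on is nondeficient. *)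
Lemma jtrue_inf k : exists2 s, k <= s & jtrue s.
Proof.
have [|v [s [ks Ts ->]] vmin] :=
  minimal_stage (P := fun v => exists s, [/\ k <= s, T s & v = least s]).
  by have [s ks Ts] := path_inf TP k; exists (least s), s.
exists s => //; split=> // t st Tt; apply: vmin; exists t; split=> //.
exact: leq_trans ks (ltnW st).
Qed.

Lemma jneg_true c s : jtrue s -> jneg c s -> ~ holds_x c.
Proof.
move=> [Ts H] ns /(path_hold TP)[t Tt ct].
case: (leqP s t) => st.
  have : jle s t; last by move=> /jneg_pers /(_ ns) [].
  split; first exact: (path_le TP).
  by move=> r sr rt; apply: H => //; apply: (path_down TP) rt.
by case: ns => _; apply; apply: (hold_pers TO) ct; apply: (path_le TP) => //; apply: ltnW.
Qed.

(** Once [least] exceeds [c] along the path, every nondeficient stage rejects [c], because [c] never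
    holds there. *)
Lemma jneg_exists c k : ~ holds_x c -> exists s, [/\ k <= s, jtrue s & jneg c s].
Proof.
move=> nc; have [k1 H] := least_unbounded c.+1.
have [s] := jtrue_inf (maxn k k1); rewrite geq_max => /andP[ks k1s] Ts.
exists s; split=> //; split; first by apply: H => //; case: Ts.
by move=> cs; apply/nc/(path_hold TP); exists s => //; case: Ts.
Qed.
End TruePath.
End Jump.

(** * Iterated jumps and their true stages *)

Section TrueStages.
Variables (E : nat -> nat -> cset) (ch : nat -> nat -> nat).
Hypothesis E0 : forall a, is_open (E 0 a).
Hypothesis ES : forall n a x, E n.+1 a x <-> exists j, ~ E n (ch a j) x.

(* The orders and events of the [n]-th jump of [x]; event [a] is [x \in E n a]. *)
Fixpoint stages (n : nat) (x : cantor) : (nat -> nat -> Prop) * (nat -> nat -> Prop) :=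
  match n with
  | 0 => (fun s t => is_true (s <= t), fun a s => forall y, agree s x y -> E 0 a y)
  | n'.+1 => let lh := stages n' x in (jle lh.1 lh.2, jhold lh.1 lh.2 ch)
  end.

Definition le n x := (stages n x).1.
Definition hold n x := (stages n x).2.
Definition neg n x := jneg (le n x) (hold n x).

Fixpoint true_stage n x : nat -> Prop :=
  if n is n'.+1 then jtrue (le n' x) (hold n' x) (true_stage n' x) else fun _ => True.

Lemma agree_sym n x y : agree n x y -> agree n y x.
Proof. by move=> H i /H. Qed.

Lemma agree_trans n x y z : agree n x y -> agree n y z -> agree n x z.
Proof. by move=> xy yz i il; rewrite xy ?yz. Qed.

Lemma agree_le m n x y : m <= n -> agree n x y -> agree m x y.
Proof. by move=> mn H i im; apply: H; apply: leq_trans mn. Qed.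

Lemma stages_tree n x : tree_order (le n x) (hold n x).
Proof.
elim: n => [|n IH].
  split; rewrite /le /hold /=; [exact: leqnn|by []|by move=> s t u; apply: leq_trans|by []|].
  by move=> a s t st H y xy; apply: H; apply: agree_le xy.
have [H1 H2 H3 H4 H5] := jump_tree_order IH ch; split=> //.
by move=> r s t rt [st _]; apply: H4 rt st.
Qed.

Lemma le_S n x s t : le n.+1 x s t -> le n x s t.
Proof. by case. Qed.

Lemma le_anti m n x s t : m <= n -> le n x s t -> le m x s t.
Proof. by move=> /subnK <-; elim: (n - m) => // k IH /le_S. Qed.

Lemma le_tree n x r s t : le n.+1 x r t -> le n x s t -> r <= s -> le n.+1 x r s.
Proof. by have [_ _ _ H _] := jump_tree_order (stages_tree n x) ch; apply: H. Qed.

(** At level [0], membership in an open set is recognised from a finite prefix. By [ES] an event of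
    level [n.+1] is the failure of some event of level [n], which is what [jhold] records. *)
Lemma stages_path n x : true_path (le n x) (hold n x) (true_stage n x) (fun a => E n a x).
Proof.
elim: n => [|n IH].
  split=> //; first by move=> k; exists k.
  move=> a; split=> [Ex|[s _]]; last exact.
  by have [s Hs] := E0 Ex; exists s.
have TO := stages_tree n x; split.
- exact: jtrue_inf IH.
- move=> s t [Ts Hs] [Tt Ht] st; split; first exact: (path_le IH).
  by move=> r sr rt; apply: Hs => //; apply: (path_down IH) rt.
- move=> s t [Tt Ht] [st Hst]; split; first exact: (path_down IH) st.
  move=> r sr Tr; case: (leqP r t) => rt; first by apply: Hst => //; apply: (path_le IH).
  apply: leq_trans (Ht r rt Tr); have := tle_leq TO st; rewrite leq_eqVlt.
  by case/orP=> [/eqP -> //|lt]; apply: Hst => //; apply: (tle_refl TO).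
- move=> a; rewrite ES; split=> [[j nj]|[s Ts [j ns]]].
    by have [s [_ Ts ns]] := jneg_exists IH 0 nj; exists s => //; exists j.
  by exists j; apply: (jneg_true TO IH) ns.
Qed.

Lemma true_stage_S n x s : true_stage n.+1 x s -> true_stage n x s.
Proof. by case. Qed.

Lemma true_stage_anti m n x s : m <= n -> true_stage n x s -> true_stage m x s.
Proof. by move=> /subnK <-; elim: (n - m) => // k IH /true_stage_S. Qed.

Lemma least_local (le1 le2 h1 h2 : nat -> nat -> Prop) s :
  (forall r, r <= s -> (forall u, le1 u r = le2 u r) /\ (forall a, h1 a r = h2 a r)) ->
  least le1 h1 s = least le2 h2 s.
Proof.
move=> H; have nE a : newly le1 h1 s a = newly le2 h2 s a.
  rewrite /newly (H s _).2 //; congr (_ /\ _); apply/propext.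
  by split=> K r rs; rewrite ?(H s _).1 // -?(H r _).2 ?(ltnW rs) //;
     move: (K r rs); rewrite ?(H s _).1 // -?(H r _).2 ?(ltnW rs).
rewrite /least; case: ex_minnP => m1 P1 H1; case: ex_minnP => m2 P2 H2.
by apply/eqP; rewrite eqn_leq H1 ?nE // H2 -?nE.
Qed.

(** Everything believed at stages up to [t] depends on the first [t] bits of [x] only; continuity of
    the reduction rests on this. *)
Lemma stages_local n x y t : agree t x y ->
  forall r, r <= t -> (forall u, le n x u r = le n y u r) /\ (forall a, hold n x a r = hold n y a r).
Proof.
elim: n t => [|n IH] t xy r rt.
  split=> // a; apply/propext; split=> H z xz; apply: H.
    exact: agree_trans (agree_le rt xy) xz.
  exact: agree_trans (agree_sym (agree_le rt xy)) xz.
have lE s : s <= t -> least (le n x) (hold n x) s = least (le n y) (hold n y) s.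
  by move=> st; apply: least_local => u us; apply: (IH t) => //; apply: leq_trans st.
split=> [u|a].
  apply/propext; split=> -[ur H].
    split; first by rewrite -/(le n y) -(IH t xy r rt).1.
    move=> v uv; rewrite -/(le n y) -(IH t xy r rt).1 => vr.
    have vt := leq_trans (tle_leq (stages_tree n x) vr) rt.
    by rewrite -!/(le n y) -!/(hold n y) -!lE //; [exact: H|exact: leq_trans (ltnW uv) vt].
  split; first by rewrite -/(le n x) (IH t xy r rt).1.
  move=> v uv; rewrite -/(le n x) (IH t xy r rt).1 => vr.
  have vt := leq_trans (tle_leq (stages_tree n y) vr) rt.
  by rewrite -!/(le n x) -!/(hold n x) !lE //; [exact: H|exact: leq_trans (ltnW uv) vt].
apply/propext; split=> -[j [jl nj]]; exists j; split.
- by rewrite -/(le n y) -/(hold n y) -lE.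
- by rewrite -/(hold n y) -(IH t xy r rt).2.
- by rewrite -/(le n x) -/(hold n x) lE.
- by rewrite -/(hold n x) (IH t xy r rt).2.
Qed.
End TrueStages.

(** * The stagewise construction of the limit structure *)

Section Construction.
Variables (I : countType) (ar : I -> nat).
Implicit Types (f g : form ar) (x : cantor).
Variables (E : nat -> nat -> cset) (ch : nat -> nat -> nat).
Hypothesis E0 : forall a, is_open (E 0 a).
Hypothesis ES : forall n a x, E n.+1 a x <-> exists j, ~ E n (ch a j) x.
Variables (lv ix : nat -> nat).
Variable K : option nat -> {M : Type & structure ar M}.
Notation Km o := (projT1 (K o)).
Notation Kst o := (projT2 (K o)).
Definition kholds o f : Prop := forall e : nat -> Km o, sat (Kst o) e f.
Hypothesis Kinh : forall o, inhabited (Km o).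
Hypothesis Kinf : forall o, infinite (Km o).
Hypothesis Kequiv : forall m f, sentence f -> rk f <= m.+1 ->
  kholds (Some m) f <-> kholds None f.
Variable F : nat -> nat * form ar.
Hypothesis F_surj : forall z f, exists k, F k = (z, f).

Notation le := (le E ch).
Notation hold := (hold E ch).
Notation neg := (neg E ch).
Notation true_stage := (true_stage E ch).

(** The clause [lv k < r] ties the level to the stage: for discoveries made before stage [n], the
    relevant order [le (lv k).+1] is implied by [le n]. This gives [decided_stable]. *)
Definition decided x s r : Prop :=
  exists k, [/\ lv k < r, r <= s, le (lv k).+1 x r s & neg (lv k) x (ix k) r].

Definition minimum (P : nat -> Prop) : option nat :=
  if pselect (exists r, P r) is left ex then Some (s2val (cid2 (minimal_stage ex))) else None.

Lemma minimumP P : match minimum P with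
  | Some r => P r /\ forall u, P u -> r <= u
  | None => forall r, ~ P r end.
Proof.
rewrite /minimum; case: pselect => [ex|nex r Pr]; last by apply: nex; exists r.
by case: cid2.
Qed.

(* The structure believed at stage [s] to be under construction: the least
   stage at which some [x \notin E (lv k) (ix k)] was discovered. *)
Definition guess x s : option nat := minimum (decided x s).

Lemma decided_stable n x r s u : le n x r s -> n <= r -> u < n -> decided x r u <-> decided x s u.
Proof.
move=> rs nr un; have TO m := stages_tree E ch m x.
split=> -[k [ku us lus nu]]; exists k; split=> //.
- exact: leq_trans us (tle_leq (TO n) rs).
- by apply: (tle_trans (TO _)) lus _; apply: le_anti rs; apply: leq_trans (ltnW un).
- exact: leq_trans (ltnW un) nr.
- apply: (tle_tree (TO _)) lus _ _; last exact: leq_trans (ltnW un) nr.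
  by apply: le_anti rs; apply: leq_trans (ltnW un).
Qed.

(** [None] counts as infinity: by [Kequiv] a far index names a structure with the same sentences of
    rank at most [n.+1] as [K None]. *)
Definition far n (o : option nat) : Prop := forall m, o = Some m -> n <= m.

(** Discoveries before stage [n] are judged alike at [r] and [s], so the two guesses coincide as
    soon as one of them is below [n]. *)
Lemma guess_stable n x r s : le n x r s -> n <= r ->
  guess x r = guess x s \/ far n (guess x r) /\ far n (guess x s).
Proof.
move=> rs nr; have D u un := decided_stable (u := u) rs nr un.
rewrite /guess; move: (minimumP (decided x r)) (minimumP (decided x s)).
case: (minimum (decided x r)) => [a|]; case: (minimum (decided x s)) => [b|].
- move=> [da amin] [db bmin]; case: (ltnP a n) => an.
    left; congr Some; apply/eqP; rewrite eqn_leq bmin ?amin //; last exact/D.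
    have ba : b <= a by apply/bmin/D.
    by apply/D => //; apply: leq_ltn_trans an.
  case: (ltnP b n) => bn; last by right; split=> m [<-].
  by move: (amin b); rewrite leqNgt (leq_trans bn an) => H; have := H ((D b bn).2 db).
- move=> [da amin] nd; right; split=> // m [<-]; case: (leqP n a) => // an.
  by case: (nd a); apply/D.
- move=> nd [db bmin]; right; split=> // m [<-]; case: (leqP n b) => // bn.
  by case: (nd b); apply/D.
- by left.
Qed.

Lemma minimum_local (P Q : nat -> Prop) : (forall r, P r <-> Q r) -> minimum P = minimum Q.
Proof. by move=> PQ; congr minimum; apply/funext => r; apply/propext. Qed.

Lemma decided_local x y s : agree s x y -> forall r, decided x s r -> decided y s r.
Proof.
move=> xy r [k [kr rs lrs [nl nh]]]; exists k; split=> //.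
  by rewrite -(stages_local E ch _ xy (leqnn s)).1.
have L u (us : u <= s) := stages_local E ch (lv k) xy us.
split; last by rewrite -(L r rs).2.
rewrite -(least_local (s := r) (le1 := le (lv k) x) (h1 := hold (lv k) x)) // => u ur.
by apply: L; apply: leq_trans rs.
Qed.

Lemma guess_local x y s : agree s x y -> guess x s = guess y s.
Proof.
by move=> xy; apply: minimum_local => r; split; apply: decided_local => //; apply: agree_sym.
Qed.

Lemma type_kholds o p f : is_type (Kst o) p -> sentence f -> p f <-> kholds o f.
Proof.
move=> tp sf; have [m] := Kinh o.
split=> [pf e|H]; first exact/(type_sentence _ tp sf).
by apply/(type_sentence (fun=> m) tp sf); apply: H.
Qed.

Lemma kholds_far n o f : far n o -> sentence f -> rk f <= n.+1 -> kholds o f <-> kholds None f.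
Proof.
by case: o => [m|] // /(_ m erefl) nm sf rf; apply: Kequiv => //; apply: leq_trans rf _.
Qed.

Lemma kholds_stable n x r s f : le n x r s -> n <= r -> sentence f -> rk f <= n.+1 ->
  kholds (guess x r) f <-> kholds (guess x s) f.
Proof.
move=> rs nr sf rf; have [->//|[H1 H2]] := guess_stable rs nr.
by rewrite (kholds_far H1) // (kholds_far H2).
Qed.

Definition state : Type := ((form ar -> Prop) * nat)%type.

(** A state is a type with the number of variables in use. Asking for agreement only when [n <= r]
    leaves finitely many levels to respect at each stage, and still covers all but finitely many
    true stages of each level. *)
Record spec x (h : nat -> state) s (st : state) : Prop := Spec {
  spec_type : is_type (Kst (guess x s)) st.1;
  spec_distinct : distinct_below st.2 st.1;
  spec_lt : forall r, r < s -> (h r).2 < st.2;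
  spec_agree : forall n r, r < s -> n <= r -> le n x r s -> agree_rk n (h r).2 (h r).1 st.1;
  spec_wit : forall k r, k < s -> r < s -> below (h r).2 (FEx (F k).1 (F k).2) ->
    st.1 (FEx (F k).1 (F k).2) -> witnessed st.2 st.1 (F k).1 (F k).2 }.

Lemma maximal_stage (P : nat -> Prop) b : (exists r, P r) -> (forall r, P r -> r <= b) ->
  exists2 r, P r & forall u, P u -> u <= r.
Proof.
move=> [r0 /asboolP Pr0] H; have ex : exists r, `[< P r >] by exists r0.
have Hb r : `[< P r >] -> r <= b by move/asboolP; exact: H.
exists (ex_maxn ex Hb); first by case: ex_maxnP => m /asboolP.
by move=> u /asboolP Pu; case: ex_maxnP => m _; apply.
Qed.

Lemma agree_rkW n l p q : agree_below l p q -> agree_rk (ar := ar) n l p q.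
Proof. by move=> pq f _ /pq. Qed.

Lemma agree_rk_trans m n l l' p q r : m <= n -> l <= l' ->
  agree_rk (ar := ar) m l p q -> agree_rk n l' q r -> agree_rk m l p r.
Proof.
move=> mn ll pq qr f rf bf; rewrite (pq f rf bf) (qr f) //; first exact: leq_trans mn.
exact: below_ge bf.
Qed.

Section Extend.
Variables (x : cantor) (h : nat -> state) (s : nat).
Hypothesis IH : forall t, t <= s -> spec x h t (h t).

Let TO n := stages_tree E ch n x.
Let cand n r := [/\ n <= r, r <= s & le n x r s.+1].

Lemma state_le r t : r <= t -> t <= s -> (h r).2 <= (h t).2.
Proof.
rewrite leq_eqVlt => /orP[/eqP -> //|rt] ts; apply: ltnW; exact: (spec_lt (IH ts)).
Qed.

Lemma agree_cand n r t : n <= r -> r <= t -> t <= s -> le n x r t ->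
  agree_rk n (h r).2 (h r).1 (h t).1.
Proof.
move=> nr; rewrite leq_eqVlt => /orP[/eqP -> //|rt] ts rlt.
exact: (spec_agree (IH ts)).
Qed.

(* Ash's amalgamation along the nested believed stages: [r] is the last stage
   [n]-believed at [s.+1]; the deeper the level, the earlier [r] and the better
   the agreement, so one walks back from the last stage to the earliest one. *)
Lemma amalgamate_stages n : (exists r, cand n r) ->
  exists r c, [/\ cand n r, forall r', cand n r' -> r' <= r,
    is_type (Kst (guess x r)) c, agree_below (h r).2 (h r).1 c &
    forall m r', m <= n -> cand m r' -> agree_rk m (h r').2 (h r').1 c].
Proof.
elim: n => [_|n IHn exr].
  exists s, (h s).1; split=> //; first by split=> //; apply: leqnSn.
  - by move=> r' [].
  - exact: spec_type (IH (leqnn s)).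
  - move=> m r'; rewrite leqn0 => /eqP -> [_ rs' _]; exact: agree_cand.
have [r1 cr1 r1max] : exists2 r, cand n.+1 r & forall u, cand n.+1 u -> u <= r.
  by apply: (maximal_stage (b := s)) => // r [].
have candS m r : cand m.+1 r -> cand m r.
  by move=> [mr rs lr]; split=> //; [exact: ltnW|exact: le_S].
have [|r [c [[nr rs lr] rmax tc rc Hc]]] := IHn; first by exists r1; apply: candS.
have r1r := rmax _ (candS _ _ cr1).
have [n1 r1s l1] := cr1.
(* The strong tree property applies: [r] is only [n]-believed at [s.+1], yet it still believes [r1]
   at level [n.+1]. So the states at [r1] and [r] agree in rank [n.+1], one more than amalgamation
   has to preserve. *)
have l1r : le n.+1 x r1 r := le_tree l1 lr r1r.
have p1c : agree_rk n.+1 (h r1).2 (h r1).1 c.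
  apply: agree_rk_trans (leqnn _) (state_le r1r rs) _ (agree_rkW rc).
  exact: agree_cand.
have [q [tq p1q cq]] := amalgamation (h s).2 (spec_type (IH r1s)) tc p1c.
exists r1, q; split=> // m r'; rewrite leq_eqVlt => /orP[/eqP -> cr'|mn cr'].
  have r'1 := r1max _ cr'; have [nr' rs' lr'] := cr'.
  apply: agree_rk_trans (leqnn _) (state_le r'1 r1s) _ (agree_rkW p1q).
  apply: agree_cand => //; exact: tle_tree (TO _) _ _ _ lr' l1 r'1.
apply: agree_rk_trans (_ : m <= n) _ (Hc m r' mn cr') cq => //.
by apply: state_le => //; case: cr'.
Qed.

Lemma extend : exists st, spec x h s.+1 st.
Proof.
have [||n exn nmax] := maximal_stage (P := fun n => exists r, cand n r) (b := s).
- by exists 0, s; split=> //; apply: leqnSn.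
- by move=> n [r [nr rs _]]; apply: leq_trans rs.
have [r [c [[nr rs lr] rmax tc rc Hc]]] := amalgamate_stages exn.
(* The guess at [s.+1] may name another structure than the guess at [r]. Amalgamating over no
   variables ([l := 0]) moves the type across, since only sentences of rank at most [n.+1] must be
   shared, and [kholds_stable] provides these. *)
have [p0 t0] := type_trivial (Kst (guess x s.+1)) (Kinh (guess x s.+1)).
have [|q [tq _ cq]] := amalgamation (n := n) (l := 0) (h s).2 t0 tc.
  move=> f rf b0; have sf : sentence f by move=> v; apply/negP => /b0.
  by rewrite (type_kholds t0 sf) (type_kholds tc sf) -(kholds_stable lr).
have qagree m r' : cand m r' -> agree_rk m (h r').2 (h r').1 q.
  move=> cr'; have mn : m <= n by apply: nmax; exists r'.
  apply: agree_rk_trans mn _ (Hc m r' mn cr') cq.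
  by apply: state_le => //; case: cr'.
(* Distinctness is quantifier-free, and stage [s] is always believed at [s.+1] at level [0]. *)
have dq : distinct_below (h s).2 q.
  move=> i j il jl ij /(qagree 0 s (And3 _ _ _)) H.
  apply: (spec_distinct (IH (leqnn s)) il jl ij); apply: H => //; first exact: leqnSn.
  by move=> v /= /orP[/eqP ->|/eqP ->].
have [q2 [l2 [ll tq2 qq2 dq2 wq2]]] := add_witnesses (@Kinf (guess x s.+1)) F s.+1 tq dq.
exists (q2, l2); split=> //=.
- by move=> r' rs'; apply: leq_ltn_trans ll; apply: state_le.
- move=> m r' rs' mr' lr'; apply: agree_rk_trans (leqnn m) _ _ (agree_rkW qq2).
    exact: state_le.
  exact: qagree.
- move=> k r' ks rs' bk qk; have bk' := below_ge (state_le (r := r') (t := s) rs' (leqnn s)) bk.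
  by apply: wq2 => //; apply/qq2.
Qed.
End Extend.

Lemma extend_any x h s : (forall t, t < s -> spec x h t (h t)) -> exists st, spec x h s st.
Proof.
case: s => [_|s H]; last exact: extend.
have [p tp] := type_trivial (Kst (guess x 0)) (Kinh (guess x 0)).
by exists (p, 0); split.
Qed.

Lemma spec_local x y h h' s st : agree s x y -> (forall r, r < s -> h r = h' r) ->
  spec x h s st -> spec y h' s st.
Proof.
move=> xy hh [H1 H2 H3 H4 H5]; split=> //.
- by rewrite -(guess_local xy).
- by move=> r rs; rewrite -hh //; apply: H3.
- move=> n r rs nr lr; rewrite -hh //; apply: H4 => //.
  by rewrite (stages_local E ch n xy (leqnn s)).1.
- by move=> k r ks rs; rewrite -hh // => /H5; apply.
Qed.

Definition choose_state (P : state -> Prop) : state :=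
  if pselect (exists st, P st) is left ex then sval (cid ex) else (fun=> True, 0).

Lemma choose_stateP (P : state -> Prop) : (exists st, P st) -> P (choose_state P).
Proof. by rewrite /choose_state; case: pselect => // ex _; case: cid. Qed.

Definition restrict s x : cantor := fun i => if i < s then x i else false.

Lemma agree_restrict s x : agree s x (restrict s x).
Proof. by move=> i; rewrite /restrict => ->. Qed.

Lemma restrict_agree s x y : agree s x y -> restrict s x = restrict s y.
Proof. by move=> xy; apply/funext => i; rewrite /restrict; case: ifP => // /xy. Qed.

(** The choice is made for the truncation of [x], so inputs with the same first [s] bits and the
    same history receive literally the same state. *)
Definition next x h s := choose_state (spec (restrict s x) h s).

Fixpoint history x s : nat -> state :=
  if s is s'.+1 then upd (history x s') s' (next x (history x s') s') else fun=> (fun=> True, 0).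

Definition st x s : state := next x (history x s) s.

Lemma history_st x s r : r < s -> history x s r = st x r.
Proof.
elim: s => // s IHs; rewrite ltnS /= /upd; case: eqP => [->//|/eqP rs rs'].
by apply: IHs; rewrite ltn_neqAle rs.
Qed.

Lemma history_local x y s : agree s x y -> history x s = history y s.
Proof.
elim: s => //= s IHs xy; have xy' := agree_le (leqnSn s) xy.
by rewrite IHs // /next (restrict_agree xy').
Qed.

Lemma st_local x y s : agree s x y -> st x s = st y s.
Proof. by move=> xy; rewrite /st (history_local xy) /next (restrict_agree xy). Qed.

Lemma st_spec x s : spec x (st x) s (st x s).
Proof.
elim/ltn_ind: s => s IHs; have [st0 H0] := extend_any IHs.
suff H : spec (restrict s x) (history x s) s (st x s).
  apply: spec_local H; first exact/agree_sym/agree_restrict.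
  by move=> r; apply: history_st.
apply: choose_stateP; exists st0; apply: spec_local H0; first exact: agree_restrict.
by move=> r rs; rewrite history_st.
Qed.

Notation ty x s := (st x s).1.
Notation lg x s := (st x s).2.

Lemma lg_lt x r s : r < s -> lg x r < lg x s.
Proof. exact: (spec_lt (st_spec x s)). Qed.

Lemma lg_le x r s : r <= s -> lg x r <= lg x s.
Proof. by rewrite leq_eqVlt => /orP[/eqP ->//|/(lg_lt x)/ltnW]. Qed.

Lemma lg_ge x s : s <= lg x s.
Proof. by elim: s => // s IHs; apply: leq_ltn_trans IHs (lg_lt _ _). Qed.

(** An atom is read at stage [varbound], where its variables are in use by [lg_ge]. Every stage is
    true at level [0], so the stages at which its variables are in use give the same answer, and
    finitely many bits of [x] suffice. *)
Definition limit x : structure ar nat :=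
  Structure (fun R t => ty x (varbound (FRel t)) (FRel t)).

Lemma limit_local x (R : I) (t : (ar R).-tuple nat) :
  exists m, forall y, agree m x y -> srel (limit x) t = srel (limit y) t.
Proof. by exists (varbound (FRel t)) => y xy /=; rewrite (st_local xy). Qed.

Lemma ty_agree n x s t : true_stage n x s -> true_stage n x t -> n <= s -> s <= t ->
  agree_rk n (lg x s) (ty x s) (ty x t).
Proof.
move=> Ts Tt ns; rewrite leq_eqVlt => /orP[/eqP -> //|lt].
apply: (spec_agree (st_spec x t)) => //.
exact: (path_le (stages_path E0 ES n x)) (ltnW lt).
Qed.

Lemma true_stage_inf n x k : exists2 s, k <= s & true_stage n x s.
Proof. exact: (path_inf (stages_path E0 ES n x)). Qed.

Lemma rk_body y f : rk f <= rk (FEx y f) /\ rk f <= rk (FAll y f).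
Proof. by move=> /=; split; case: ifP. Qed.

(** The renamed body occurs in the list [F] at some index [k], and [spec_wit] takes care of it at
    all stages past [k] and [s]. *)
Lemma witness_at x y f (env : nat -> nat) s :
  (forall v, free v (FEx y f) -> env v < lg x s) ->
  exists k, forall u, s < u -> k < u -> ty x u (subst env (FEx y f)) ->
    exists2 m, m < lg x u & ty x u (subst (upd env y m) f).
Proof.
move=> be; have [k Fk] := F_surj (fresh env f) (subst (upd env y (fresh env f)) f).
exists k => u su ku pu.
have := spec_wit (st_spec x u) ku su; rewrite Fk => /(_ _ pu)[|m mu pm].
  exact: (below_subst (f := FEx y f)).
exists m => //; apply: (type_mono (spec_type (st_spec x u))) pm => e.
rewrite !sat_subst (@sat_free _ _ _ _ _ _ (e \o upd env y m)) //.
move=> v vf; rewrite /upd /=; case: (v == y); rewrite ?eqxx //.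
by rewrite ltn_eqF ?lt_fresh.
Qed.

(** Truth lemma by induction on [f], with the level [n] fixed: two [n]-true stages from [n] on agree
    on formulas of rank at most [n], so a quantifier can be examined at a later true stage where the
    witness or the instance is in use. *)
Lemma limit_truth f x (env : nat -> nat) n s : rk f <= n ->
  true_stage n x s -> n <= s -> (forall v, free v f -> env v < lg x s) ->
  sat (limit x) env f <-> ty x s (subst env f).
Proof.
have ts w := spec_type (st_spec x w).
have below_upd env0 y g s0 m t : s0 <= t -> m < lg x t ->
    (forall v, free v (FEx y g) -> env0 v < lg x s0) ->
    forall v, free v g -> upd env0 y m v < lg x t.
  move=> st mt H v vg; rewrite /upd; case: eqP => // /eqP vy.
  by apply: leq_trans (lg_le x st); apply: H; rewrite /= vy.
have up env0 g s0 t : rk g <= n -> true_stage n x s0 -> true_stage n x t -> n <= s0 -> s0 <= t ->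
    (forall v, free v g -> env0 v < lg x s0) ->
    ty x s0 (subst env0 g) <-> ty x t (subst env0 g).
  move=> rg Ts Tt ns st b; apply: (ty_agree Ts Tt ns st); first by rewrite rk_subst.
  exact: below_subst.
elim: f env s => [R t|i j||g IH|g IHg h IHh|g IHg h IHh|g IHg h IHh|y g IH|y g IH] env s.
- move=> _ _ ns be; rewrite /=; set f := FRel (map_tuple env t).
  have A0 v w : v <= w -> agree_rk 0 (lg x v) (ty x v) (ty x w).
    by move=> vw; apply: ty_agree.
  have bs : below (lg x s) f := below_subst (f := FRel t) be.
  have bf : below (lg x (varbound f)) f.
    by move=> v /free_varbound /leq_trans; apply; apply: lg_ge.
  by case: (leqP s (varbound f)) => [su|/ltnW us]; [rewrite (A0 _ _ su)|rewrite (A0 _ _ us)].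
- move=> _ _ ns be; split=> [/= ->|].
    by apply: (type_valid (ts s)) => e.
  apply: contraPP => /eqP ij; apply: (spec_distinct (st_spec x s)) => //; apply: be => /=;
    by rewrite eqxx ?orbT.
- by move=> _ _ _ _; split=> // /(type_sat (ts s))[].
- by move=> rg Ts ns bg /=; rewrite (IH _ s) // (type_neg (ts s)).
- rewrite [rk _]/= geq_max => /andP[rg rh] Ts ns be /=.
  rewrite (IHg _ s) ?(IHh _ s) // ?(type_and (ts s)) // => v vf; apply: be => /=; by rewrite vf ?orbT.
- rewrite [rk _]/= geq_max => /andP[rg rh] Ts ns be /=.
  rewrite (type_equiv (g := FNeg (FAnd (FNeg (subst env g)) (FNeg (subst env h)))) (ts s)); last first.
    by move=> e /=; case: (pselect (sat (Kst (guess x s)) e (subst env g)));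
      case: (pselect (sat (Kst (guess x s)) e (subst env h))); tauto.
  rewrite (type_neg (ts s)) (type_and (ts s)) !(type_neg (ts s)).
  rewrite (IHg _ s) ?(IHh _ s) //.
  + by case: (pselect (ty x s (subst env g))); case: (pselect (ty x s (subst env h))); tauto.
  + by move=> v vf; apply: be => /=; rewrite vf orbT.
  + by move=> v vf; apply: be => /=; rewrite vf.
- rewrite [rk _]/= geq_max => /andP[rg rh] Ts ns be /=.
  rewrite (type_equiv (g := FNeg (FAnd (subst env g) (FNeg (subst env h)))) (ts s)); last first.
    by move=> e /=; case: (pselect (sat (Kst (guess x s)) e (subst env h))); tauto.
  rewrite (type_neg (ts s)) (type_and (ts s)) !(type_neg (ts s)).
  rewrite (IHg _ s) ?(IHh _ s) //.
  + by case: (pselect (ty x s (subst env h))); tauto.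
  + by move=> v vf; apply: be => /=; rewrite vf orbT.
  + by move=> v vf; apply: be => /=; rewrite vf.
- move=> rf Ts ns be; have rg := leq_trans (rk_body y g).2 rf.
  have IHm m t : s <= t -> true_stage n x t -> m < lg x t ->
      sat (limit x) (upd env y m) g <-> ty x t (subst (upd env y m) g).
    move=> st Tt mt; apply: IH => //; first exact: leq_trans st.
    exact: below_upd be.
  have inst M (A : structure ar M) (e : nat -> M) m : sat A e (subst env (FAll y g)) ->
      sat A e (subst (upd env y m) g).
    rewrite !sat_subst /= => /(_ (e m)); rewrite (@sat_free _ _ _ _ _ _ (e \o upd env y m)) //.
    by move=> v _; rewrite /upd /=; case: eqP.
  split=> [H|ps m].
    (* If the type rejects the universal formula, a later true stage supplies a witness for the
       negated body, against the assumed instance. *)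
    apply: contrapT => /(type_neg (ts s)) nps.
    have [k wk] := witness_at (f := FNeg g) be.
    have [t] := true_stage_inf n x (maxn s.+1 k.+1); rewrite geq_max => /andP[st kt] Tt.
    have /(type_neg (ts t)) npt : ~ ty x t (subst env (FAll y g)).
      by rewrite -(up env _ s t) //; [exact/(type_neg (ts s))|exact: ltnW].
    have [|m mt] := wk t st kt.
      apply: (type_mono (ts t)) npt => e.
      by rewrite -/(subst env (FNeg (FAll y g))) !sat_subst => /existsNP.
    by move=> /(type_neg (ts t)); apply; apply/(IHm m t) => //; exact: ltnW.
  have [t] := true_stage_inf n x (maxn s m.+1); rewrite geq_max => /andP[st mt] Tt.
  have mlt : m < lg x t by apply: leq_trans mt (lg_ge _ _).
  apply/(IHm m t) => //; move/(up env _ s t rf Ts Tt ns st be): ps.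
  by apply: (type_mono (ts t)) => e; apply: inst.
- move=> rf Ts ns be; have rg := leq_trans (rk_body y g).1 rf.
  have IHm m t : s <= t -> true_stage n x t -> m < lg x t ->
      sat (limit x) (upd env y m) g <-> ty x t (subst (upd env y m) g).
    move=> st Tt mt; apply: IH => //; first exact: leq_trans st.
    exact: below_upd be.
  split=> [[m H]|ps].
    have [t] := true_stage_inf n x (maxn s m.+1); rewrite geq_max => /andP[st mt] Tt.
    have mlt : m < lg x t by apply: leq_trans mt (lg_ge _ _).
    apply/(up env _ s t rf Ts Tt ns st be); move/(IHm m t st Tt mlt): H.
    apply: (type_mono (ts t)) => e; rewrite !sat_subst => H; exists (e m).
    move: H; rewrite (@sat_free _ _ _ _ _ _ (upd (e \o env) y (e m))) //.
    by move=> v _; rewrite /upd /=; case: eqP.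
  have [k wk] := witness_at be.
  have [t] := true_stage_inf n x (maxn s.+1 k.+1); rewrite geq_max => /andP[st kt] Tt.
  have /(wk t st kt)[m mt pm] : ty x t (subst env (FEx y g)).
    by apply/(up env _ s t) => //; exact: ltnW.
  by exists m; apply/(IHm m t) => //; exact: ltnW.
Qed.

Lemma limit_sentence f x (env : nat -> nat) n s : sentence f -> rk f <= n ->
  true_stage n x s -> n <= s -> sat (limit x) env f <-> kholds (guess x s) f.
Proof.
move=> sf rf Ts ns; have ts := spec_type (st_spec x s).
rewrite (limit_truth rf Ts ns); last by move=> v; rewrite sf.
rewrite -(type_kholds ts sf); apply: (type_equiv ts) => e; rewrite sat_subst.
by apply: sat_free => v; rewrite sf.
Qed.

(** At a true stage of level [rk f] the guess is far. A guess [m] below [rk f] would be a true stage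
    of level [(lv k).+1] that rejects an event containing [x], which [jneg_true] forbids. *)
Lemma limit_inside x : (forall k, E (lv k) (ix k) x) ->
  forall f env, sentence f -> kholds None f -> sat (limit x) env f.
Proof.
move=> Ex f env sf Hf; have [s ns Ts] := true_stage_inf (rk f) x (rk f).
apply/(limit_sentence env sf (leqnn _) Ts ns); apply/(kholds_far (n := rk f)) => // m.
have := minimumP (decided x s); rewrite -/(guess x s) => + E1; rewrite E1.
move=> [[k [km ms lms nm]] _]; case: leqP => // mf.
have Tm : true_stage (lv k).+1 x m.
  apply: (path_down (stages_path E0 ES _ x)) lms.
  by apply: true_stage_anti Ts; apply: leq_trans km (ltnW mf).
by case: (jneg_true (stages_tree E ch _ x) (stages_path E0 ES _ x) Tm nm).
Qed.

(** Some true stage [r] discovers the failure, so the guesses at sufficiently true stages are at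
    most [r], and stability makes them all equal. *)
Lemma limit_outside x : (exists k, ~ E (lv k) (ix k) x) ->
  exists m, forall f env, sentence f -> sat (limit x) env f <-> kholds (Some m) f.
Proof.
move=> [k nE].
have [r [kr Tr nr]] := jneg_exists (stages_path E0 ES _ x) (lv k).+1 nE.
(* [N] exceeds [r], so the guesses in question are never far at level [N]; it also covers the level
   at which [r] must be believed. *)
pose N := maxn r.+1 (lv k).+1.
have G s : N <= s -> true_stage N x s -> exists2 m, guess x s = Some m & m < N.
  move=> Ns Ts; have := minimumP (decided x s); rewrite -/(guess x s).
  have dr : decided x s r.
    exists k; split=> //; first by apply: leq_trans Ns; rewrite /N; lia.
    apply: (path_le (stages_path E0 ES _ x)) => //.
      by apply: true_stage_anti Ts; rewrite /N; lia.
    by apply: leq_trans Ns; rewrite /N; lia.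
  case: (guess x s) => [m [_ /(_ r dr) mr]|/(_ r) //]; exists m => //.
  by rewrite /N; lia.
have [s0 Ns0 Ts0] := true_stage_inf N x N; have [m0 Em m0N] := G s0 Ns0 Ts0.
exists m0 => f env sf.
(* The level grows with [f], but the guess does not: an [n]-true stage is [N]-true, hence still
   guesses [m0]. *)
pose n := maxn N (rk f).
have [s ns Ts] := true_stage_inf n x (maxn n s0).
move: ns; rewrite geq_max => /andP[ns s0s].
have TsN : true_stage N x s by apply: true_stage_anti Ts; rewrite /n; lia.
rewrite (limit_sentence env (n := n) (s := s) sf) //; last by rewrite /n; lia.
have := guess_stable (path_le (stages_path E0 ES N x) Ts0 TsN s0s) Ns0.
by rewrite Em => -[<- //|[/(_ m0 erefl)]]; rewrite leqNgt m0N.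
Qed.
End Construction.

(** * Borel classes of finite rank, universal sets and non-collapse *)

Section BorelHierarchy.
Implicit Types (A B : cset) (x y c : cantor).

Lemma cset_ext A B : (forall x, A x <-> B x) -> A = B.
Proof. by move=> AB; apply/funext => x; apply/propext. Qed.

Lemma complK A : compl (compl A) = A.
Proof. by apply: cset_ext => x; split=> [/contrapT|Ax nAx]; last exact: nAx. Qed.

Lemma continuous_agree (f : cantor -> cantor) : continuous_cantor f ->
  forall x n, exists m, forall y, agree m x y -> agree n (f x) (f y).
Proof.
move=> cf x; elim=> [|n [m IH]]; first by exists 0.
have [m' H] := cf x n; exists (maxn m m') => y xy i.
rewrite ltnS leq_eqVlt => /orP[/eqP ->|].
  by apply/esym/H; apply: agree_le xy; apply: leq_maxr.
by apply: IH; apply: agree_le xy; apply: leq_maxl.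
Qed.

Lemma Sigma0_preimage n A (f : cantor -> cantor) :
  continuous_cantor f -> Sigma0 n A -> Sigma0 n (A \o f).
Proof.
move=> cf; elim: n A => [|[|n] IH] A //.
  move=> oA x /oA[n H]; have [m Hm] := continuous_agree cf x n.
  by exists m => y /Hm /H.
by move=> [B [SB AB]]; exists (fun k => B k \o f); split=> [k|x]; [exact: (IH (compl (B k)) (SB k))|exact: AB].
Qed.

Lemma Sigma0_of_compl n A : Sigma0 n.+1 (compl A) -> Sigma0 n.+2 A.
Proof. by move=> SA; exists (fun=> A); split=> // x; split=> [|[]//]; exists 0. Qed.

Lemma Sigma0_bigcup n (A : nat -> cset) :
  (forall k, Sigma0 n.+1 (A k)) -> Sigma0 n.+1 (fun x => exists k, A k x).
Proof.
case: n => [|n] SA.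
  by move=> x [k /SA[m H]]; exists m => y /H; exists k.
have [B HB] := choice SA.
pose C i := if unpickle i is Some (k, j) then B k j else B 0 0.
exists C; split=> [i|x].
  by rewrite /C; case: unpickle => [[k j]|]; apply: (HB _).1.
split=> [[k /(HB k).2[j Bx]]|[i]]; first by exists (pickle (k, j)); rewrite /C pickleK.
by rewrite /C; case: unpickle => [[k j]|] Bx; [exists k|exists 0]; apply/(HB _).2;
   [exists j|exists 0].
Qed.

Definition Delta n A : Prop := Sigma0 n A /\ Sigma0 n (compl A).

Lemma Delta_compl n A : Delta n A -> Delta n (compl A).
Proof. by rewrite /Delta complK => -[]. Qed.

Lemma Delta_le m n A : m <= n -> Delta m.+1 A -> Delta n.+1 A.
Proof.
move=> /subnK <-; elim: (n - m) => // k IH /IH[S1 S2].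
by split; apply: Sigma0_of_compl => //; rewrite complK.
Qed.

Lemma Delta_bigcup n (A : nat -> cset) :
  (forall k, Delta n.+1 (A k)) -> Delta n.+2 (fun x => exists k, A k x).
Proof.
move=> DA; split; first by exists A; split=> // k; case: (DA k).
apply: Sigma0_of_compl; rewrite complK; apply: Sigma0_bigcup => k; by case: (DA k).
Qed.

Lemma Delta_or n A B : Delta n.+1 A -> Delta n.+1 B -> Delta n.+2 (fun x => A x \/ B x).
Proof.
move=> DA DB; rewrite (_ : (fun x => _) = fun x => exists k : nat, (if k is 0 then A else B) x).
  by apply: Delta_bigcup => -[].
by apply: cset_ext => x; split=> [[Ax|Bx]|[[|k]]]; [exists 0|exists 1|left|right].
Qed.

Definition finitely_determined A : Prop :=
  exists m, forall x y, agree m x y -> A x <-> A y.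

Lemma determined_Delta n A : finitely_determined A -> Delta n.+1 A.
Proof.
move=> [m H]; apply: (@Delta_le 0) => //; split=> x Ax; exists m => y xy; first exact/(H x y xy).
by move=> /(H x y xy).
Qed.

Definition col c (k : nat) : cantor := fun i : nat => c (pickle (k, i)).

(* [U n c] is the [Sigma0 n.+1] set with code [c]. *)
Fixpoint U n c y : Prop :=
  match n with
  | 0 => exists m, c (pickle (mkseq y m)) = true
  | n'.+1 => exists k, ~ U n' (col c k) y
  end.

Lemma mkseq_agree n x y : mkseq x n = mkseq y n <-> agree n x y.
Proof.
split=> [E i il|H]; last by apply/eq_in_map => i; rewrite mem_iota => /andP[_ /H].
by rewrite -(nth_mkseq false x il) E nth_mkseq.
Qed.

Lemma U_universal n A : Sigma0 n.+1 A -> exists c, forall y, U n c y <-> A y.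
Proof.
elim: n A => [|n IH] A.
  move=> oA; exists (fun j => `[< exists x m, pickle (mkseq x m) = j /\
                                 forall y, agree m x y -> A y >]) => y; split.
    move=> [m /asboolP[x [m' [/(pcan_inj pickleK) E H]]]].
    have mm : m' = m by rewrite -(size_mkseq x m') E size_mkseq.
    by rewrite mm in E H; apply/H/mkseq_agree.
  by move=> /oA[m H]; exists m; apply/asboolP; exists y, m.
move=> [B [SB AB]]; have [c Hc] := choice (fun k => IH _ (SB k)).
pose d : cantor := fun i => if unpickle i is Some (k, j) then c k j else false.
exists d => y; have UE k : U n (col d k) y <-> ~ B k y.
  rewrite (_ : col d k = c k); first exact: Hc.
  by apply/funext => j; rewrite /col /d pickleK.
rewrite AB /=; split=> -[k H]; exists k; last by move/UE.
by apply: contrapT => /UE.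
Qed.

Lemma continuous_col (g : cantor -> cantor) k :
  continuous_cantor g -> continuous_cantor (fun x => col (g x) k).
Proof. by move=> cg x n; apply: cg. Qed.

Lemma U_Sigma0 n (g h : cantor -> cantor) : continuous_cantor g -> continuous_cantor h ->
  Sigma0 n.+1 (fun x => U n (g x) (h x)).
Proof.
elim: n g => [|n IH] g cg ch.
  move=> x [m gx]; have [m1 H1] := cg x (pickle (mkseq (h x) m)).
  have [m2 H2] := continuous_agree ch x m.
  exists (maxn m1 m2) => y xy; exists m.
  have /mkseq_agree <- := H2 y (agree_le (leq_maxr _ _) xy).
  by rewrite H1 //; apply: agree_le xy; apply: leq_maxl.
exists (fun k x => ~ U n (col (g x) k) (h x)); split=> // k.
rewrite -/(compl (fun x => U n (col (g x) k) (h x))) complK.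
by apply: IH => //; apply: continuous_col.
Qed.

Lemma continuous_id : continuous_cantor id.
Proof. by move=> x m; exists m.+1 => y ->. Qed.

(** Cantor's diagonal: a code [c] for the complement of the diagonal set is contradictory when
    evaluated at [c] itself. *)
Lemma diagonal_not_Pi0 n :
  exists2 A, Sigma0 n.+1 A & ~ Sigma0 n.+1 (compl A).
Proof.
exists (fun x => U n x x); first exact: (U_Sigma0 n continuous_id continuous_id).
by move=> /U_universal[c /(_ c)]; rewrite /compl; tauto.
Qed.
End BorelHierarchy.

(** * Enumeration of formulas *)

Section FormulaCode.
Variables (I : countType) (ar : I -> nat).

Fixpoint code (f : form ar) : GenTree.tree nat :=
  match f with
  | FRel R t => GenTree.Node 0 [:: GenTree.Leaf (pickle (@existT I (fun R => (ar R).-tuple nat) R t))]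
  | FEq i j => GenTree.Node 1 [:: GenTree.Leaf i; GenTree.Leaf j]
  | FFalse => GenTree.Node 2 [::]
  | FNeg g => GenTree.Node 3 [:: code g]
  | FAnd g h => GenTree.Node 4 [:: code g; code h]
  | FOr g h => GenTree.Node 5 [:: code g; code h]
  | FImp g h => GenTree.Node 6 [:: code g; code h]
  | FAll x g => GenTree.Node 7 [:: GenTree.Leaf x; code g]
  | FEx x g => GenTree.Node 8 [:: GenTree.Leaf x; code g]
  end.

Fixpoint decode (t : GenTree.tree nat) : form ar :=
  match t with
  | GenTree.Node 0 [:: GenTree.Leaf c] =>
      if (unpickle c : option {R : I & (ar R).-tuple nat}) is Some (existT R t) then FRel t
      else FFalse ar
  | GenTree.Node 1 [:: GenTree.Leaf i; GenTree.Leaf j] => FEq ar i j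
  | GenTree.Node 3 [:: g] => FNeg (decode g)
  | GenTree.Node 4 [:: g; h] => FAnd (decode g) (decode h)
  | GenTree.Node 5 [:: g; h] => FOr (decode g) (decode h)
  | GenTree.Node 6 [:: g; h] => FImp (decode g) (decode h)
  | GenTree.Node 7 [:: GenTree.Leaf x; g] => FAll x (decode g)
  | GenTree.Node 8 [:: GenTree.Leaf x; g] => FEx x (decode g)
  | _ => FFalse ar
  end.

Lemma codeK : cancel code decode.
Proof.
by elim=> //= [R t|g ->|g -> h ->|g -> h ->|g -> h ->|x g ->|x g ->] //; rewrite pickleK.
Qed.

Lemma form_enumeration : exists F : nat -> form ar, forall f, exists k, F k = f.
Proof.
exists (fun k => if unpickle k is Some t then decode t else FFalse ar) => f.
by exists (pickle (code f)); rewrite pickleK codeK.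
Qed.

Lemma witness_enumeration : exists F : nat -> nat * form ar, forall z f, exists k, F k = (z, f).
Proof.
have [F HF] := form_enumeration.
exists (fun k => if unpickle k is Some (z, i) then (z, F i) else (0, FFalse ar)) => z f.
by have [i <-] := HF f; exists (pickle (z, i)); rewrite pickleK.
Qed.
End FormulaCode.

(** * The Borel complexity of the space of models *)

Section Models.
Variables (I : countType) (ar : I -> nat).
Implicit Types (T S : theory ar) (f g : form ar) (x y : cantor).

(** It makes sense for every [x], diagram or not, so satisfaction defines subsets of the whole
    Cantor space; the conditions [diagram_at] then cut out [ModTau]. *)
Definition decoded x : structure ar nat :=
  Structure (fun R t => x (pickle (inl (existT _ R t) : atom ar)) = true).

Definition diagram_at n x : Prop :=
  x n = true <-> exists a : atom ar, pickle a = n /\ atom_holds (decoded x) a.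

Lemma diagram_atom (A : structure ar nat) x (a : atom ar) :
  diagram_of A x -> x (pickle a) = true <-> atom_holds A a.
Proof.
move=> dA; rewrite dA; split=> [[b [/(pcan_inj pickleK) -> //]]|aA]; by exists a.
Qed.

Lemma diagram_sat (A B : structure ar nat) x f (e : nat -> nat) :
  diagram_of A x -> diagram_of B x -> sat A e f <-> sat B e f.
Proof.
move=> dA dB; elim: f e => [R t|i j||g IH|g IHg h IHh|g IHg h IHh|g IHg h IHh|z g IH|z g IH] e //=.
- pose a : atom ar := inl (existT _ R (map_tuple e t)).
  by rewrite -[srel A _]/(atom_holds A a) -(diagram_atom _ dA) (diagram_atom _ dB).
- by rewrite IH.
- by rewrite IHg IHh.
- by rewrite IHg IHh.
- by rewrite IHg IHh.
- by split=> H m; apply/IH.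
- by split=> -[m H]; exists m; apply/IH.
Qed.

Lemma decodedP x : ModTau ar x <-> forall n, diagram_at n x.
Proof.
split=> [[A dA] n|H]; last by exists (decoded x); apply: H.
rewrite /diagram_at dA; split=> -[a [<- aA]]; exists a; split=> //.
  by case: a aA => [[R t]|[i j]] //= aA; apply/(diagram_atom _ dA).
by case: a aA => [[R t]|[i j]] //= aA; move/(diagram_atom _ dA): aA.
Qed.

Lemma ModTP T x : (forall f, T f -> sentence f) ->
  ModT T x <-> (forall n, diagram_at n x) /\ forall f, T f -> sat (decoded x) id f.
Proof.
move=> Ts; split=> [[A [dA mA]]|[dx mx]].
  have dx : forall n, diagram_at n x by apply/(decodedP x).1; exists A.
  by split=> // f Tf; apply/(diagram_sat f id (dx : diagram_of (decoded x) x) dA)/mA.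
exists (decoded x); split=> // f Tf env; exact: sat_sentence (Ts f Tf) (mx f Tf).
Qed.

Lemma diagram_at_determined n : finitely_determined (diagram_at n).
Proof.
exists n.+1 => x y xy; have nE := xy n (ltnSn n).
have aE a : pickle a = n -> atom_holds (decoded x) a <-> atom_holds (decoded y) a.
  by case: a => [[R t]|[i j]] //= E; rewrite E nE.
rewrite /diagram_at nE; split=> ->; split=> -[a [E H]]; exists a; split=> //; exact/(aE a E).
Qed.

Lemma qfree_determined f (e : nat -> nat) : qfree f -> finitely_determined (fun x => sat (decoded x) e f).
Proof.
elim: f => [R t|i j||g IH|g IHg h IHh|g IHg h IHh|g IHg h IHh|z g IH|z g IH] //=.
- by move=> _; exists (pickle (inl (existT _ R (map_tuple e t)) : atom ar)).+1 => x y ->.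
- by exists 0.
- by exists 0.
- by move=> /IH[m H]; exists m => x y /H ->.
- move=> /andP[/IHg[m H] /IHh[m' H']]; exists (maxn m m') => x y xy.
  by rewrite (H x y) ?(H' x y) //; apply: agree_le xy; rewrite ?leq_maxl ?leq_maxr.
- move=> /andP[/IHg[m H] /IHh[m' H']]; exists (maxn m m') => x y xy.
  by rewrite (H x y) ?(H' x y) //; apply: agree_le xy; rewrite ?leq_maxl ?leq_maxr.
- move=> /andP[/IHg[m H] /IHh[m' H']]; exists (maxn m m') => x y xy.
  by rewrite (H x y) ?(H' x y) //; apply: agree_le xy; rewrite ?leq_maxl ?leq_maxr.
Qed.

(** The level is shifted by one because quantifier-free formulas define clopen sets, which already
    sit at [Sigma0 1]. *)
Lemma prenex_Sigma0 :
  (forall n f, AllN n f -> forall e : nat -> nat, Sigma0 n.+1 (fun x => ~ sat (decoded x) e f)) /\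
  (forall n f, ExN n f -> forall e : nat -> nat, Sigma0 n.+1 (fun x => sat (decoded x) e f)).
Proof.
apply: AllN_ExN_mutind.
- by move=> f qf e; have [_] := determined_Delta 0 (qfree_determined e qf).
- by move=> n f _ IH e; apply: Sigma0_of_compl; rewrite -/(compl (fun x => sat (decoded x) e f)) complK.
- move=> n z f _ IH e; rewrite (_ : (fun x => _) = fun x => exists m, ~ sat (decoded x) (upd e z m) f).
    exact: Sigma0_bigcup.
  by apply: cset_ext => x; split=> [/existsNP //|[m nf] H]; exact/nf/H.
- by move=> f qf e; have [] := determined_Delta 0 (qfree_determined e qf).
- by move=> n f _ IH e; apply: Sigma0_of_compl; exact: (IH e).
- by move=> n z f _ IH e; apply: (@Sigma0_bigcup n.+1 (fun m x => sat (decoded x) (upd e z m) f)) => m.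
Qed.

(** A crude bound in which most connectives cost a level; only its finiteness matters. *)
Lemma sat_Delta f : exists n, forall e : nat -> nat, Delta n.+1 (fun x => sat (decoded x) e f).
Proof.
have Dimp n A B : Delta n.+1 A -> Delta n.+1 B -> Delta n.+2 (fun x => A x -> B x).
  move=> DA DB; rewrite (_ : (fun x => _) = fun x => compl A x \/ B x).
    by apply: Delta_or => //; apply: Delta_compl.
  by apply: cset_ext => x; rewrite /compl; case: (pselect (A x)); tauto.
have Dand n A B : Delta n.+1 A -> Delta n.+1 B -> Delta n.+2 (fun x => A x /\ B x).
  move=> DA DB; rewrite (_ : (fun x => _) = compl (fun x => A x -> compl B x)).
    by apply/Delta_compl/Dimp => //; apply: Delta_compl.
  by apply: cset_ext => x; rewrite /compl; case: (pselect (A x)); case: (pselect (B x)); tauto.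
elim: f => [R t|i j||g [n H]|g [n H] h [n' H']|g [n H] h [n' H']|g [n H] h [n' H']|z g [n H]|z g [n H]].
- by exists 0 => e; apply/determined_Delta/qfree_determined.
- by exists 0 => e; apply/determined_Delta/qfree_determined.
- by exists 0 => e; apply/determined_Delta/qfree_determined.
- by exists n => e; apply: Delta_compl.
- exists (maxn n n').+1 => e; apply: Dand; first exact: Delta_le (leq_maxl _ _) (H e).
  exact: Delta_le (leq_maxr _ _) (H' e).
- exists (maxn n n').+1 => e; apply: Delta_or; first exact: Delta_le (leq_maxl _ _) (H e).
  exact: Delta_le (leq_maxr _ _) (H' e).
- exists (maxn n n').+1 => e; apply: Dimp; first exact: Delta_le (leq_maxl _ _) (H e).
  exact: Delta_le (leq_maxr _ _) (H' e).
- exists n.+1 => e; rewrite (_ : (fun x => _) = compl (fun x => exists m, ~ sat (decoded x) (upd e z m) g)).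
    by apply/Delta_compl/Delta_bigcup => m; apply: Delta_compl.
  by apply: cset_ext => x; split=> [Hx [m]|/forallNP Hx m]; [apply|apply: contrapT].
- by exists n.+1 => e; apply: Delta_bigcup.
Qed.

Lemma ModT_Pi0omega T : (forall f, T f -> sentence f) -> Pi0omega (ModT T).
Proof.
move=> Ts; have [F HF] := form_enumeration ar.
(* Odd indices carry the diagram conditions, even indices the axioms. *)
exists (fun j x => if odd j then diagram_at j./2 x else T (F j./2) -> sat (decoded x) id (F j./2)).
split=> [j|x].
  case: (odd j).
    by exists 1; have [] := determined_Delta 0 (diagram_at_determined j./2).
  have [Tf|nTf] := pselect (T (F j./2)).
    have [n /(_ id)[S _]] := sat_Delta (F j./2); exists n.+1.
    by rewrite (_ : (fun x => _) = fun x => sat (decoded x) id (F j./2)) //; apply: cset_ext => x; tauto.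
  by exists 1 => x _; exists 0.
rewrite ModTP //; split=> [[H1 H2] j|H]; first by case: (odd j) => // /H2.
split=> [n|f Tf]; first by have := H n.*2.+1; rewrite /= odd_double uphalf_double.
by have [k E] := HF f; have := H k.*2; rewrite odd_double doubleK E; apply.
Qed.

Lemma AllN_axiomatizable_Pi0 S n : (forall f, S f -> sentence f /\ AllN n f) ->
  Sigma0 n.+1 (compl (ModT S)).
Proof.
move=> HS; have [F HF] := form_enumeration ar.
rewrite (_ : compl _ = fun x => exists j, if odd j then ~ diagram_at j./2 x
  else S (F j./2) /\ ~ sat (decoded x) id (F j./2)).
  apply: Sigma0_bigcup => j; case: (odd j).
    by have [] := determined_Delta n (diagram_at_determined j./2).
  have [Sf|nSf] := pselect (S (F j./2)).
    rewrite (_ : (fun x => _) = fun x => ~ sat (decoded x) id (F j./2)).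
      by apply: prenex_Sigma0.1; case: (HS _ Sf).
    by apply: cset_ext => x; tauto.
  have [|+ _] := determined_Delta n (A := fun=> False); first by exists 0.
  by rewrite (_ : (fun x => _) = fun=> False) //; apply: cset_ext => x; tauto.
apply: cset_ext => x; rewrite /compl ModTP; last by move=> f /HS[].
split=> [H|[j] + [H1 H2]]; last by case: (odd j) => [|[/H2]//]; apply.
apply: contrapT => nex; apply: H; split=> [n0|f Sf].
  apply: contrapT => nd; apply: nex; exists n0.*2.+1.
  by rewrite /= odd_double uphalf_double.
apply: contrapT => nf; apply: nex; have [k E] := HF f.
by exists k.*2; rewrite odd_double doubleK E.
Qed.

Lemma ModT_equiv T S : (forall f, T f -> sentence f) -> (forall f, S f -> sentence f) ->
  equiv_theories T S -> ModT T = ModT S.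
Proof.
move=> Ts Ss TS; apply: cset_ext => x; split=> -[A [dA mA]]; exists A; split=> // f Hf.
  by apply: ((TS f (Ss f Hf)).2 _ nat A (inhabits 0)) => // M B _ mB; apply: mB.
by apply: ((TS f (Ts f Hf)).1 _ nat A (inhabits 0)) => // M B _ mB; apply: mB.
Qed.

(** A bounded axiomatization makes the complement of [ModT T] a [Sigma0 n.+1] set. Reducing to
    [ModT T] a [Sigma0 n.+1] set whose complement is not [Sigma0 n.+1] then contradicts closure
    under continuous preimages. *)
Lemma bounded_not_hard T : (forall f, T f -> sentence f) ->
  boundedly_axiomatizable T -> ~ Pi0omega_hard (ModTau ar) (ModT T).
Proof.
move=> Ts [n [S [HS TS]]] hard.
have [A SA nA] := diagonal_not_Pi0 n; apply: nA.
have [|f [cf [_ Af]]] := hard A.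
  by exists (fun=> A); split=> [k|x]; [exists n.+1|split=> // /(_ 0)].
rewrite (_ : compl A = compl (ModT S) \o f).
  by apply: Sigma0_preimage => //; apply: AllN_axiomatizable_Pi0.
rewrite -(ModT_equiv Ts _ TS); last by move=> g /HS[].
by apply: cset_ext => x; rewrite /compl Af.
Qed.
End Models.

(** * Non-models that agree with a model up to a given rank *)

Section Approximation.
Variables (I : countType) (ar : I -> nat).
Implicit Types (T S : theory ar) (f g : form ar).

Lemma injective_infinite (M : Type) (g : nat -> M) : injective g -> infinite M.
Proof.
move=> ginj l e; apply: contrapT => nex.
have H j : exists i : 'I_l, e i = g j.
  apply: contrapT => nei; apply: nex; exists (g j) => i il E.
  by apply: nei; exists (Ordinal il).
have [c Hc] := choice H.
have cinj : injective (fun j : 'I_l.+1 => c j).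
  by move=> i j E; apply/val_inj/ginj; rewrite -!Hc E.
by have := leq_card _ cinj; rewrite !card_ord ltnn.
Qed.

(** These sentences have rank at most 2 and together express infinity, so agreement in rank 2
    carries infinity over to the non-models. *)
Definition more_than l : form ar :=
  alls (iota 0 l) (FEx l (ands [seq FNeg (FEq ar i l) | i <- iota 0 l])).

Lemma more_than_sentence l : sentence (more_than l).
Proof.
move=> x; rewrite free_alls mem_iota /=; case: (ltnP x l) => //= lx.
case: eqP => //= /eqP xl; apply/negbTE.
suff : forall s, {subset s <= iota 0 l} ->
    ~~ free x (ands [seq FNeg (FEq ar i l) | i <- s]) by apply.
elim=> //= i s IH sub; rewrite (negbTE xl) orbF negb_or IH ?andbT.
  have := sub i (mem_head _ _); rewrite mem_iota => /andP[_ il].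
  by apply/eqP => E; move: lx; rewrite E leqNgt il.
by move=> j js; apply: sub; rewrite inE js orbT.
Qed.

Lemma rk_more_than l : rk (more_than l) <= 2.
Proof.
have rk_alls ys f : rk (alls ys f) <= (rk f).+1.
  by elim: ys => [|y [|z ys] IH] //=; case: isAll.
apply: leq_trans (rk_alls _ _) _; rewrite ltnS /=.
have -> : rk (ands [seq FNeg (FEq ar i l) | i <- iota 0 l]) = 0 by elim: (iota 0 l) => //= i s ->.
by case: ifP.
Qed.

Lemma more_thanP M (A : structure ar M) : infinite M <->
  forall l (e : nat -> M), sat A e (more_than l).
Proof.
split=> [Minf l e|H l e].
  apply: sat_alls => e' /=; have [w Hw] := Minf l e'; exists w.
  by apply/sat_ands => i il /=; rewrite /upd eqxx (ltn_eqF il); apply: Hw.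
have /sat_alls_inv /= [w /sat_ands Hw] := H l e; exists w => i il.
by have := Hw i il; rewrite /= /upd eqxx (ltn_eqF il).
Qed.

Lemma complete_conseq T M (A : structure ar M) f : complete_theory T -> inhabited M ->
  is_model A T -> sentence f -> (conseq T f <-> forall e : nat -> M, sat A e f).
Proof.
move=> [_ [_ Tc]] Mi mA sf; split=> [Tf e|H]; first exact: Tf.
have [//|nTf] := Tc f sf; have [m] := Mi.
by case: (nTf M A Mi mA (fun=> m)); apply: H.
Qed.

(** The [AllN n.+1] consequences of [T] do not axiomatize [T], so one of their models refutes some
    consequence [f0] of [T]. It satisfies all sentences of rank at most [n] true in [A]; as rank is
    invariant under negation, it satisfies no others. *)
Lemma approximate_nonmodel T n M (A : structure ar M) : complete_theory T -> inhabited M ->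
  is_model A T -> ~ AllN_axiomatizable n.+1 T ->
  exists (NB : {N : Type & structure ar N}) f0,
    [/\ inhabited (projT1 NB), sentence f0, conseq T f0,
        ~ (forall e, sat (projT2 NB) e f0) &
        forall f, sentence f -> rk f <= n ->
          (forall e, sat (projT2 NB) e f) <-> (forall e : nat -> M, sat A e f)].
Proof.
move=> Tc Mi mA nax.
pose S f := [/\ sentence f, AllN n.+1 f & conseq T f].
have ST f : conseq S f -> conseq T f.
  move=> Sf N B Ni mB; apply: Sf => // g [_ _ Tg]; exact: Tg.
have [f0 [sf0 Tf0 nSf0]] : exists f0, [/\ sentence f0, conseq T f0 & ~ conseq S f0].
  apply: contrapT => nex; apply: nax; exists S; split=> [f []//|f sf].
  by split=> [Tf|/ST //]; apply: contrapT => nSf; apply: nex; exists f.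
have [N [B [Ni mB nB]]] : exists (N : Type) (B : structure ar N),
    [/\ inhabited N, is_model B S & ~ forall e, sat B e f0].
  apply: contrapT => nex; apply: nSf0 => N B Ni mB e.
  by apply: contrapT => ne; apply: nex; exists N, B; split=> // /(_ e).
exists (existT _ N B), f0; split=> //=.
have AB f : sentence f -> rk f <= n -> (forall e : nat -> M, sat A e f) ->
    forall e, sat B e f.
  move=> sf rf /(complete_conseq Tc Mi mA sf) Tf e.
  have [g [sg Ag gf]] := sentence_AllN sf rf; apply/(gf N B e)/mB; split=> //.
  by move=> M' A' Mi' mA' e'; apply/gf/Tf.
move=> f sf rf; split=> [Bf e|]; last exact: AB.
apply: contrapT => nf; have [b] := Ni.
apply: (AB (FNeg f) sf rf _ (fun=> b) (Bf _)) => e' /= fe'; apply: nf.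
exact: sat_sentence fe'.
Qed.
End Approximation.

(** * Events for the construction, and the equivalence *)

Lemma Pi0omega_events (A : cset) : Pi0omega A ->
  exists (E : nat -> nat -> cset) (ch : nat -> nat -> nat) (lv ix : nat -> nat),
  [/\ forall a, is_open (E 0 a),
      forall n a x, E n.+1 a x <-> exists j, ~ E n (ch a j) x &
      forall x, A x <-> forall k, E (lv k) (ix k) x].
Proof.
move=> [B [SB AB]].
have SB' k : exists n, Sigma0 n.+1 (B k) by have [[|n] Sn] := SB k => //; exists n.
have [lv Hlv] := choice SB'.
have [c Hc] := choice (fun k => U_universal (Hlv k)).
(* An index [a] stands for the code [c k] followed by a path of columns, which makes one function
   [ch] serve all levels. Indices that decode to nothing get the zero code, all of whose columns are
   again zero. *)
pose D (a : nat) : cantor := if unpickle a is Some (k, s) then foldl col (c k) s else fun=> false.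
pose ch (a j : nat) : nat :=
  if unpickle a is Some (k, s) then pickle (k : nat, rcons s j : seq nat) else a.
have Dch a j : D (ch a j) = col (D a) j.
  rewrite /D /ch; case Ea: (unpickle a) => [[k s]|]; last by rewrite Ea.
  by rewrite pickleK -cats1 foldl_cat.
exists (fun n a => U n (D a)), ch, lv, (fun k => pickle (k, [::] : seq nat)); split.
- move=> a; have cst : continuous_cantor (fun=> D a) by move=> x n; exists 0.
  exact: (U_Sigma0 0 cst continuous_id).
- by move=> n a x /=; split=> -[j H]; exists j; move: H; rewrite Dch.
- move=> x; rewrite AB; split=> H k; have := H k; rewrite /D pickleK /=; by move/Hc.
Qed.

Theorem theorem3p2 (I : countType) (ar : I -> nat) (T : theory ar) :
  complete_theory T -> has_infinite_model T ->
  (Pi0omega_complete (ModTau ar) (ModT T) <-> ~ boundedly_axiomatizable T).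
Proof.
move=> Tc [M [A [g [ginj mA]]]]; have Ts : forall f, T f -> sentence f by case: Tc.
split=> [[hard _] bd|nbd]; first exact: bounded_not_hard Ts bd hard.
split; last exact: ModT_Pi0omega.
have Mi : inhabited M := inhabits (g 0).
have Minf := injective_infinite ginj.
(* The shift by 3 yields agreement up to rank [m.+2]: rank [m.+1] for the construction, and rank 2
   even at [m = 0] for [more_than]. *)
have [NB HNB] := choice (fun m => approximate_nonmodel Tc Mi mA
  (fun ax => nbd (ex_intro _ m.+3 ax))).
pose K (o : option nat) := if o is Some m then NB m else existT _ M A.
have Kinh o : inhabited (projT1 (K o)).
  by case: o => [m|] //=; case: (HNB m) => f0 [].
have Kequiv m f : sentence f -> rk f <= m.+2 -> kholds K (Some m) f <-> kholds K None f.
  by case: (HNB m) => f0 [_ _ _ _ H] sf rf; exact: H.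
have Kinf o : infinite (projT1 (K o)).
  case: o => [m|] //; apply/more_thanP => l e.
  apply: (Kequiv m _ (more_than_sentence _ l) _).2.
    exact: leq_trans (rk_more_than _ l) _.
  by move=> e'; apply: (more_thanP A).1.
have [F HF] := witness_enumeration ar.
move=> B /Pi0omega_events[E [ch [lv [ix [E0 ES HB]]]]].
pose L x := limit E ch lv ix K F x.
pose d x : cantor := fun n => `[< exists a : atom ar, pickle a = n /\ atom_holds (L x) a >].
have dL x : diagram_of (L x) (d x) by move=> n; split=> [/asboolP|H]; last exact/asboolP.
have Kequiv1 m f : sentence f -> rk f <= m.+1 -> kholds K (Some m) f <-> kholds K None f.
  by move=> sf rf; apply: Kequiv => //; apply: leq_trans rf _.
exists d; split=> [x n|].
  have [[a an]|na] := pselect (exists a : atom ar, pickle a = n); last first.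
    by exists 0 => y _; apply/asboolP/asboolP => -[a [an _]]; case: na; exists a.
  have [m Hm] : exists m, forall y, agree m x y -> atom_holds (L x) a = atom_holds (L y) a.
    case: a {an} => [[R t]|[i j]]; last by exists 0.
    exact: limit_local.
  exists m => y /Hm xy; rewrite /d -an.
  by apply/asboolP/asboolP => -[b [/(pcan_inj pickleK) -> H]]; exists a; split=> //; move: H; rewrite xy.
split=> [x|x]; first by exists (L x).
rewrite HB; split=> [Ex|[A' [dA' mA']]].
  exists (L x); split=> // f Tf env.
  apply: (limit_inside E0 ES Kinh Kinf Kequiv1 HF Ex) => //; first exact: Ts.
  by move=> e; apply: mA.
(* Outside [B] the limit has the theory of some [NB m], which refutes the consequence [f0] of
   [T]. *)
apply: contrapT => /existsNP nE.
have [m Hm] := limit_outside E0 ES Kinh Kinf Kequiv1 HF nE.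
have [f0 [_ sf0 Tf0 nf0 _]] := HNB m; apply: nf0; apply/(Hm f0 id sf0).
by apply/(diagram_sat f0 id (dL x) dA'); apply: Tf0 mA' _; exact: (inhabits 0).
Qed.
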